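(* Let $\mathbf X_1,\dots,\mathbf X_n$ be independent uniform points in $\mathcal S_n$ with hidden embedding $\Psi(v)=\mathbf X_v$, and suppose we are given only the family of vertex orderings $(\tau_v:v\in V)$, each as a linked list. There is an algorithm running in linear time (in $n$) that outputs an embedding $\Phi:V\to\mathbb R^2$ such that whp $d^*(\Psi,\Phi)<1.197\sqrt{\log n}$.
   Context: For a positive integer $n$ let $\mathcal S_n=[-\sqrt n/2,\sqrt n/2]^2$ and $V=[n]$. For each $v\in V$, $\tau_v$ is the ordering of all vertices of $V$ by increasing Euclidean distance $\|\mathbf X_w-\mathbf X_v\|_2$ (ties occur with probability $0$); the computational model assumes the successor of a given element in a given list $\tau_u$ can be found in constant time and real arithmetic has unit cost. For maps $\Phi_1,\Phi_2:V\to\mathbb R^2$, $d^*(\Phi_1,\Phi_2)=\min_\sigma \max_{v\in V}\|\sigma(\Phi_1(v))-\Phi_2(v)\|_2$, the minimum over the 8 symmetries $\sigma$ of the square $\mathcal S_n$. ''whp'' means with probability tending to $1$ as $n\to\infty$. *)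

(* Defs.v *)
From HB Require Import structures.
From mathcomp Require Import all_boot all_order all_algebra.
From mathcomp Require Import all_classical all_reals all_analysis.
From mathcomp Require Import Rstruct.
Set Implicit Arguments. Unset Strict Implicit. Unset Printing Implicit Defensive.
Import Order.TTheory GRing.Theory Num.Theory.
Local Open Scope ring_scope.

Section Defs.
Variable R : realType.

(* Geometry.  Vertices are 0, ..., n-1 (the paper's [n] shifted by 1). *)
Definition dist2 (p q : R * R) : R :=
  Num.sqrt ((p.1 - q.1) ^+ 2 + (p.2 - q.2) ^+ 2).

Definition Sn (n : nat) : set (R * R) :=
  [set p | `|p.1| <= Num.sqrt n%:R / 2 /\ `|p.2| <= Num.sqrt n%:R / 2].

(* tau_u : all vertices ordered by increasing distance to X_u
   (stable sort: ties, which have probability 0, broken by index). *)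
Definition tau (X : nat -> R * R) (n u : nat) : seq nat :=
  if (u < n)%N then sort (fun a b => dist2 (X u) (X a) <= dist2 (X u) (X b)) (iota 0 n)
  else [::].

Definition sq_syms : seq (R * R -> R * R) :=
  [:: (fun p => (p.1, p.2)); (fun p => (- p.1, p.2)); (fun p => (p.1, - p.2));
      (fun p => (- p.1, - p.2)); (fun p => (p.2, p.1)); (fun p => (- p.2, p.1));
      (fun p => (p.2, - p.1)); (fun p => (- p.2, - p.1))].

Definition dmax (n : nat) (sigma : R * R -> R * R) (Phi1 Phi2 : nat -> R * R) : R :=
  \big[Num.max/0]_(v < n) dist2 (sigma (Phi1 v)) (Phi2 v).

Definition dstar (n : nat) (Phi1 Phi2 : nat -> R * R) : R :=
  foldr (fun s acc => Num.min (dmax n s Phi1 Phi2) acc)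
        (dmax n (fun p => p) Phi1 Phi2) sq_syms.

(* Computational model: a real-RAM with an oracle for the lists tau_u.
   Integer memory N : nat -> nat, real memory F : nat -> R.
   Each instruction costs one step.                                    *)
Inductive instr :=
| NConst (d k : nat)
| NAdd (d a b : nat)
| NSub (d a b : nat)              (* N[d] := N[a] - N[b] (truncated) *)
| NMul (d a b : nat)
| NDiv (d a b : nat)
| NLoad (d a : nat)
| NStore (a s : nat)
| RConst (d : nat) (c : rat)
| RFromN (d a : nat)
| RAdd (d a b : nat)
| RSub (d a b : nat)
| RMul (d a b : nat)
| RDiv (d a b : nat)
| RLoad (d a : nat)
| RStore (a s : nat)
| Jmp (l : nat)
| JNLt (a b l : nat)
| JRLt (a b l : nat)
| First (d u : nat)               (* N[d] := first element of tau_{N[u]} (n if empty) *)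
| Succ (d u w : nat)              (* N[d] := successor of N[w] in tau_{N[u]} (n if none) *)
| Halt.

Record config := Config { pc : nat; Nmem : nat -> nat; Fmem : nat -> R }.

Definition upd {A : Type} (f : nat -> A) (k : nat) (x : A) : nat -> A :=
  fun j => if j == k then x else f j.

Definition oracle_first (X : nat -> R * R) (n u : nat) : nat :=
  head n (tau X n u).

Definition oracle_succ (X : nat -> R * R) (n u w : nat) : nat :=
  let s := tau X n u in if w \in s then nth n s (index w s).+1 else n.

Definition step (prog : seq instr) (X : nat -> R * R) (n : nat) (c : config)
  : option config :=
  let N := Nmem c in let F := Fmem c in let p := pc c in
  let nx := p.+1 in
  match nth Halt prog p with
  | NConst d k => Some (Config nx (upd N d k) F)
  | NAdd d a b => Some (Config nx (upd N d (N a + N b)%N) F)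
  | NSub d a b => Some (Config nx (upd N d (N a - N b)%N) F)
  | NMul d a b => Some (Config nx (upd N d (N a * N b)%N) F)
  | NDiv d a b => Some (Config nx (upd N d (N a %/ N b)%N) F)
  | NLoad d a => Some (Config nx (upd N d (N (N a))) F)
  | NStore a s => Some (Config nx (upd N (N a) (N s)) F)
  | RConst d q => Some (Config nx N (upd F d (ratr q)))
  | RFromN d a => Some (Config nx N (upd F d (N a)%:R))
  | RAdd d a b => Some (Config nx N (upd F d (F a + F b)))
  | RSub d a b => Some (Config nx N (upd F d (F a - F b)))
  | RMul d a b => Some (Config nx N (upd F d (F a * F b)))
  | RDiv d a b => Some (Config nx N (upd F d (F a / F b)))
  | RLoad d a => Some (Config nx N (upd F d (F (N a))))
  | RStore a s => Some (Config nx N (upd F (N a) (F s)))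
  | Jmp l => Some (Config l N F)
  | JNLt a b l => Some (Config (if (N a < N b)%N then l else nx) N F)
  | JRLt a b l => Some (Config (if F a < F b then l else nx) N F)
  | First d u => Some (Config nx (upd N d (oracle_first X n (N u))) F)
  | Succ d u w => Some (Config nx (upd N d (oracle_succ X n (N u) (N w))) F)
  | Halt => None
  end.

Definition init (n : nat) : config := Config 0 (upd (fun _ => 0%N) 0 n) (fun _ => 0).

Fixpoint run (prog : seq instr) (X : nat -> R * R) (n k : nat) (c : config) : config :=
  match k with
  | 0 => c
  | k'.+1 => match step prog X n c with
             | None => c
             | Some c' => run prog X n k' c'
             end
  end.

Definition halted (prog : seq instr) (X : nat -> R * R) (n : nat) (c : config) : Prop :=
  step prog X n c = None.

Definition halts_within (prog : seq instr) (X : nat -> R * R) (n k : nat) : Prop :=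
  halted prog X n (run prog X n k (init n)).

Definition output (c : config) : nat -> R * R :=
  fun v => (Fmem c (2 * v)%N, Fmem c (2 * v).+1).

Definition linear_time (prog : seq instr) : Prop :=
  exists C : nat, forall (n : nat) (X : nat -> R * R), halts_within prog X n (C * n.+1).

Definition succeeds (prog : seq instr) (X : nat -> R * R) (n : nat) (r : R) : Prop :=
  exists k, halts_within prog X n k /\ dstar n X (output (run prog X n k (init n))) < r.

End Defs.

Local Open Scope classical_set_scope.

Definition iid_uniform_Sn (R : realType) (d : measure_display) (T : measurableType d)
  (P : probability T R) (n : nat) (X : nat -> T -> R * R) : Prop :=
  (forall v, (v < n)%N -> measurable_fun setT (X v)) /\
  (* each X_v is uniform on S_n (area of S_n is n) *)
  (forall v, (v < n)%N -> forall A : set (R * R), measurable A ->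
     P (X v @^-1` A) =
       ((lebesgue_measure \x lebesgue_measure) (A `&` @Sn R n) * (n%:R^-1)%:E)%E) /\
  (forall A : nat -> set (R * R), (forall v, measurable (A v)) ->
     P (\bigcap_(v in [set v | (v < n)%N]) (X v @^-1` A v)) =
       (\prod_(v < n) P (X v @^-1` A v))%E).

(* Main.v *)
(* Idea.  Cut the square into M^2 equal cells, where M = isqrt n.  The points fall
   into independent uniform cells, so a Chernoff bound, followed by a union bound
   over constantly many coarse levels and all the fine ones, shows that whp, for
   every corner k and every s, the number of points whose cell (i, j), counted
   from k, satisfies i^2 + j^2 <= s differs from the number L(s) of such cells by
   at most [eps * sqrt (n ln n)].  Since L grows at a linear rate up to s = 1.3 M^2,
   the rank of v in tau_u, for a vertex u near k, determines the squared distance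
   from v to k up to O(eps * sqrt (n ln n)): it is read off a table of the sorted
   values of i^2 + j^2, which takes linear time and needs no transcendental
   function.  Four vertices near the corners come from farthest points: a is
   farthest from vertex 0, b from a, c from a vertex z that is far from both a and
   b, and d from c.  A difference of squared distances to two adjacent corners is
   linear in one coordinate, and each point is at distance at most 1.12 sqrt n
   from two adjacent corners on its own side of the square.  This gives an error
   O(eps * sqrt (ln n)) for every fixed eps > 0, and the theorem only needs the
   constant 1.197. *)
Require Import Defs.
From HB Require Import structures.
From mathcomp Require Import all_boot all_order all_algebra.
From mathcomp Require Import all_classical all_reals all_analysis.
From mathcomp Require Import Rstruct.
From mathcomp Require Import zify ring lra.
Set Implicit Arguments. Unset Strict Implicit. Unset Printing Implicit Defensive.
Import Order.TTheory GRing.Theory Num.Theory.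

Local Open Scope nat_scope.

(** * A structured language on top of the real RAM *)

(** The difficulty is the constant in front of [sqrt (ln n)]. A plain union bound over all 2 M^2
    levels forces deviations of a fixed multiple of [sqrt (n ln n)], and later steps multiply them:
    inverting the growth of L alone costs a factor 20. The deviation must therefore be
    [c * sqrt (n ln n)] with [c] small. For one event Chernoff then gives only the probability n^(-
    c^2 / 8), which tolerates boundedly many events. This is why there are K + 1 coarse levels with
    K about 18 / c^2: what separates a level from a coarse one has density at most 1 / K, hence so
    small a variance that its deviations have probability O(n^-2). The same smallness is needed of
    the distance between [a], [b], [c], [d] and the true corners, so blocks of side about
    [c * sqrt (ln n)] at the corners must be occupied. Near 2 M^2 the growth of L slows down, and
    ranks say little about distances. Hence each coordinate is computed from one of two pairs of
    corners, and the program must decide from inexact estimates which pair can be trusted. *)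

Record hst (R : realType) :=
  Hst { reg : nat -> nat; arr : nat -> nat -> nat; fmem : nat -> R }.

(* [Nat.eqb] rather than [==], so that [cbv] evaluates lookups at literals. *)
Definition rset (g : nat -> nat) d x : nat -> nat :=
  fun r => if Nat.eqb r d then x else g r.

Definition updA (A : nat -> nat -> nat) k i x : nat -> nat -> nat :=
  fun k' => if Nat.eqb k' k then upd (A k) i x else A k'.

Lemma nat_eqbE (a b : nat) : Nat.eqb a b = (a == b).
Proof. by apply/idP/eqP => /PeanoNat.Nat.eqb_eq. Qed.

Inductive hinstr :=
| HConst (d k : nat) | HAdd (d a b : nat) | HSub (d a b : nat)
| HMul (d a b : nat) | HDiv (d a b : nat)
| HLd (d k i : nat) | HSt (k i s : nat)
| HFirst (d u : nat) | HSucc (d u w : nat)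
| HFromN (d a : nat) | HRSub (d a b : nat) | HRDiv (d a b : nat)
| HRLoad (d a : nat) | HRStore (a s : nat).

Inductive cmd :=
| Block of seq hinstr
| Seq of cmd & cmd
| While (a b : nat) of cmd.

(* Cell [i] of array [k < 8] lives at address [8 * i + (32 + k)]; the registers
   30 and 31 are scratch space for computing such addresses. *)
Definition lower (h : hinstr) : seq instr :=
  match h with
  | HConst d k => [:: NConst d k]
  | HAdd d a b => [:: NAdd d a b]
  | HSub d a b => [:: NSub d a b]
  | HMul d a b => [:: NMul d a b]
  | HDiv d a b => [:: NDiv d a b]
  | HLd d k i => [:: NConst 30 8; NMul 30 30 i; NConst 31 (32 + k);
                     NAdd 30 30 31; NLoad d 30]
  | HSt k i s => [:: NConst 30 8; NMul 30 30 i; NConst 31 (32 + k);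
                     NAdd 30 30 31; NStore 30 s]
  | HFirst d u => [:: First d u]
  | HSucc d u w => [:: Succ d u w]
  | HFromN d a => [:: RFromN d a]
  | HRSub d a b => [:: RSub d a b]
  | HRDiv d a b => [:: RDiv d a b]
  | HRLoad d a => [:: RLoad d a]
  | HRStore a s => [:: RStore a s]
  end.

Definition wf_instr (h : hinstr) : bool :=
  match h with
  | HConst d k => d < 30
  | HAdd d a b | HSub d a b | HMul d a b | HDiv d a b =>
      [&& d < 30, a < 30 & b < 30]
  | HLd d k i | HSt k i d => [&& d < 30, i < 30 & k < 8]
  | HFirst d u => (d < 30) && (u < 30)
  | HSucc d u w => [&& d < 30, u < 30 & w < 30]
  | HFromN _ a | HRLoad _ a | HRStore a _ => a < 30
  | HRSub _ _ _ | HRDiv _ _ _ => true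
  end.

Definition lowers (l : seq hinstr) : seq instr := flatten (map lower l).

(** Jump targets of the machine are absolute, hence the argument [off]. A loop begins with a
    conditional jump over its exit jump, as there is no negated test. *)
Fixpoint code (off : nat) (c : cmd) : seq instr :=
  match c with
  | Block l => lowers l
  | Seq c1 c2 => let p := code off c1 in p ++ code (off + size p) c2
  | While a b c =>
      let p := code (off + 2) c in
      [:: JNLt a b (off + 2), Jmp (off + (size p).+3) & p ++ [:: Jmp off]]
  end.

Lemma code_while off a b c : code off (While a b c) =
  [:: JNLt a b (off + 2), Jmp (off + (size (code (off + 2) c)).+3)
    & code (off + 2) c ++ [:: Jmp off]].
Proof. by []. Qed.

Section Semantics.
Variables (R : realType) (X : nat -> R * R) (n : nat).
Implicit Types (st : hst R) (prog : seq instr).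

Definition heval st (h : hinstr) : hst R :=
  let g := reg st in let A := arr st in let F := fmem st in
  match h with
  | HConst d k => Hst (rset g d k) A F
  | HAdd d a b => Hst (rset g d (g a + g b)) A F
  | HSub d a b => Hst (rset g d (g a - g b)) A F
  | HMul d a b => Hst (rset g d (g a * g b)) A F
  | HDiv d a b => Hst (rset g d (g a %/ g b)) A F
  | HLd d k i => Hst (rset g d (A k (g i))) A F
  | HSt k i s => Hst g (updA A k (g i) (g s)) F
  | HFirst d u => Hst (rset g d (oracle_first X n (g u))) A F
  | HSucc d u w => Hst (rset g d (oracle_succ X n (g u) (g w))) A F
  | HFromN d a => Hst g A (upd F d (g a)%:R%R)
  | HRSub d a b => Hst g A (upd F d (F a - F b)%R)
  | HRDiv d a b => Hst g A (upd F d (F a / F b)%R)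
  | HRLoad d a => Hst g A (upd F d (F (g a)))
  | HRStore a s => Hst g A (upd F (g a) (F s))
  end.

(** Nothing is required of registers 30 and 31, so address computations preserve the relation. *)
Definition sim (N : nat -> nat) st :=
  (forall r, r < 30 -> N r = reg st r) /\
  (forall k i, k < 8 -> N (8 * i + (32 + k)) = arr st k i).

Definition code_at prog off (l : seq instr) :=
  forall j, j < size l -> nth Halt prog (off + j) = nth Halt l j.

Lemma code_at_cat prog off l1 l2 : code_at prog off (l1 ++ l2) ->
  code_at prog off l1 /\ code_at prog (off + size l1) l2.
Proof.
move=> H; split=> j jl.
- by rewrite H ?size_cat ?nth_cat ?jl //; lia.
- rewrite -addnA H ?size_cat ?nth_cat; last by lia.
  by rewrite (_ : (size l1 + j < size l1) = false) ?addKn //; lia.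
Qed.

Lemma code_at_cons prog off i l : code_at prog off (i :: l) ->
  nth Halt prog off = i /\ code_at prog off.+1 l.
Proof.
move=> H; split; first by have := H 0; rewrite addn0; apply.
by move=> j jl; rewrite addSnnS H.
Qed.

Lemma run_add prog k1 k2 c :
  run prog X n (k1 + k2) c = run prog X n k2 (run prog X n k1 c).
Proof.
elim: k1 c => [//|k1 IH] c; rewrite addSn /=.
case E: (step prog X n c) => [c'|]; first exact: IH.
by case: k2 {IH} => //= k2; rewrite E.
Qed.

(** Quantifying over the surrounding program and the offset makes the statement compositional. The
    real memory needs no simulation: both levels share it. *)
Definition exec (c : cmd) (k : nat) st st' :=
  forall prog off N, code_at prog off (code off c) -> sim N st ->
  exists2 N', run prog X n k (Config off N (fmem st)) =
              Config (off + size (code off c)) N' (fmem st') & sim N' st'.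

Lemma sim_upd N st d x : d < 30 -> sim N st ->
  sim (upd N d x) (Hst (rset (reg st) d x) (arr st) (fmem st)).
Proof.
move=> dl [H1 H2]; split=> [r rl|k i kl] /=; rewrite /rset ?nat_eqbE /upd.
- by case: eqP => // _; exact: H1.
- by case: eqP => [|_]; [lia | exact: H2].
Qed.

Lemma sim_scratch N st d x : 30 <= d < 32 -> sim N st -> sim (upd N d x) st.
Proof.
move=> dl [H1 H2]; split=> [r rl|k i kl] /=; rewrite /upd.
- by case: eqP => [|_]; [lia | exact: H1].
- by case: eqP => [|_]; [lia | exact: H2].
Qed.

Lemma sim_array N st k i x : k < 8 -> sim N st ->
  sim (upd N (8 * i + (32 + k)) x) (Hst (reg st) (updA (arr st) k i x) (fmem st)).
Proof.
move=> kl [H1 H2]; split=> [r rl|k' i' kl'] /=; rewrite /updA ?nat_eqbE /upd.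
- by case: eqP => [|_]; [lia | exact: H1].
- case: (eqVneq k' k) => [->|kk].
  + case: (eqVneq i' i) => [->|ii]; first by rewrite eqxx.
    by case: eqP => [|_]; [lia | exact: H2].
  + by case: eqP => [|_]; [lia | exact: H2].
Qed.

Lemma exec_instr h st prog off N : wf_instr h ->
  code_at prog off (lower h) -> sim N st ->
  exists2 N', run prog X n (size (lower h)) (Config off N (fmem st)) =
              Config (off + size (lower h)) N' (fmem (heval st h)) &
              sim N' (heval st h).
Proof.
case: st => g A F w H S; have [S1 S2] := S; move: w H.
case: h => [d k|d a b|d a b|d a b|d a b|d k i|k i s|d u|d u v|d a|d a b|d a b|d a|a s] /=;
  try (move=> w /code_at_cons[E _]; rewrite /step E /= addn1; eexists;
       [reflexivity | by rewrite /= ?S1; try lia;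
        (apply: (@sim_upd N (Hst g A F)) => //; lia)]).
- move=> w /code_at_cons[E /code_at_cons[E1 /code_at_cons[E2 /code_at_cons[E3 /code_at_cons[E4 _]]]]].
  rewrite /step E /= E1 /= E2 /= E3 /= E4 /=.
  eexists; first by congr Config; lia.
  rewrite [in upd _ d _]/upd /=.
  rewrite (_ : (i == 30) = false); last by lia.
  rewrite S1; last by lia.
  rewrite (_ : (8 * g i + (32 + k) == 30) = false); last by lia.
  rewrite (_ : (8 * g i + (32 + k) == 31) = false); last by lia.
  rewrite S2; last by lia.
  apply: (@sim_upd _ (Hst g A F)); first by lia.
  by do 4! [apply: sim_scratch => //].
- move=> w /code_at_cons[E /code_at_cons[E1 /code_at_cons[E2 /code_at_cons[E3 /code_at_cons[E4 _]]]]].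
  rewrite /step E /= E1 /= E2 /= E3 /= E4 /=.
  eexists; first by congr Config; lia.
  set N' := upd (upd (upd (upd N 30 8) _ _) _ _) _ _.
  have sN' : sim N' (Hst g A F) by do 4! [apply: sim_scratch => //].
  have -> : N' s = g s by case: sN' => -> //; lia.
  have -> : N' 30 = 8 * g i + (32 + k).
    rewrite /N' /upd /= (_ : (i == 30) = false) ?S1 //; lia.
  by apply: (@sim_array _ (Hst g A F)) => //; lia.
- move=> w /code_at_cons[E _]; rewrite /step E /= addn1 S1 //.
  by exists N.
- by move=> _ /code_at_cons[E _]; rewrite /step E /= addn1; exists N.
- by move=> _ /code_at_cons[E _]; rewrite /step E /= addn1; exists N.
- move=> w /code_at_cons[E _]; rewrite /step E /= addn1 S1 //.
  by exists N.
- move=> w /code_at_cons[E _]; rewrite /step E /= addn1 S1 //.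
  by exists N.
Qed.

Lemma exec_block l st : all wf_instr l ->
  exec (Block l) (size (lowers l)) st (foldl heval st l).
Proof.
elim: l st => [|h l IH] st /=.
  by move=> _ prog off N _ S; exists N => //=; rewrite addn0.
move=> /andP[wh wl] prog off N /code_at_cat[H1 H2] S.
rewrite /lowers /= size_cat run_add.
have [N' -> S'] := exec_instr wh H1 S.
have [N'' /= ] := IH _ wl _ _ _ H2 S'.
by rewrite /lowers => -> S''; exists N''; rewrite ?addnA.
Qed.

Lemma exec_seq c1 c2 k1 k2 st st' st'' :
  exec c1 k1 st st' -> exec c2 k2 st' st'' -> exec (Seq c1 c2) (k1 + k2) st st''.
Proof.
move=> H1 H2 prog off N /= /code_at_cat[A1 A2] S.
have [N' E1 S'] := H1 _ _ _ A1 S.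
have [N'' E2 S''] := H2 _ _ _ A2 S'.
by exists N'' => //; rewrite run_add E1 E2 size_cat addnA.
Qed.

Lemma exec_while_true a b c k1 k2 st st' st'' : a < 30 -> b < 30 ->
  reg st a < reg st b -> exec c k1 st st' -> exec (While a b c) k2 st' st'' ->
  exec (While a b c) (k1 + 2 + k2) st st''.
Proof.
move=> al bl lt H1 H2 prog off N A S.
have := A; rewrite code_while => /code_at_cons[E0 /code_at_cons[_ /code_at_cat[A1 /code_at_cons[E3 _]]]].
have [S1 _] := S.
have -> : k1 + 2 + k2 = 1 + (k1 + (1 + k2)) by lia.
rewrite run_add /= /step E0 /= !S1 // lt.
rewrite run_add.
have A1' : code_at prog (off + 2) (code (off + 2) c) by rewrite {1}addn2.
have [N' E1 S'] := H1 _ _ _ A1' S.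
rewrite E1 run_add.
have E3' : nth Halt prog (off + 2 + size (code (off + 2) c)) = Jmp off.
  by rewrite -E3 {1}addn2.
rewrite /run /step /= E3' -/(run _ _ _ _ _).
have [N'' E2 S''] := H2 _ _ _ A S'.
by exists N''.
Qed.

Lemma exec_while_false a b c st : a < 30 -> b < 30 ->
  ~~ (reg st a < reg st b) -> exec (While a b c) 2 st st.
Proof.
move=> al bl /negbTE lt prog off N A S.
move: A; rewrite code_while => /code_at_cons[E0 /code_at_cons[E1 _]].
have [S1 _] := S.
rewrite /= /step E0 /= !S1 // lt E1 /=.
exists N => //; congr Config; rewrite size_cat /=; lia.
Qed.

(** A Hoare triple for total correctness, with the step bound [K]. *)
Definition triple (P : hst R -> Prop) (c : cmd) (K : nat) (Q : hst R -> Prop) :=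
  forall st, P st -> exists k st', [/\ k <= K, exec c k st st' & Q st'].

Lemma triple_weaken P c K K' (Q Q' : hst R -> Prop) :
  triple P c K Q -> K <= K' -> (forall st, Q st -> Q' st) -> triple P c K' Q'.
Proof.
move=> H KK QQ st /H[k [st' [kK E q]]]; exists k, st'.
by split=> //; [exact: leq_trans KK | exact: QQ].
Qed.

Lemma triple_block (P Q : hst R -> Prop) l : all wf_instr l ->
  (forall st, P st -> Q (foldl heval st l)) ->
  triple P (Block l) (size (lowers l)) Q.
Proof.
move=> w H st p; exists (size (lowers l)), (foldl heval st l).
by split; [|exact: exec_block|exact: H].
Qed.

Lemma triple_seq P Q S c1 c2 K1 K2 :
  triple P c1 K1 Q -> triple Q c2 K2 S -> triple P (Seq c1 c2) (K1 + K2) S.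
Proof.
move=> H1 H2 st /H1[k1 [s1 [l1 E1 /H2[k2 [s2 [l2 E2 q]]]]]].
by exists (k1 + k2), s2; split; [lia | exact: exec_seq E1 E2 |].
Qed.

(** Each round pays two steps for the test and the jump back; the final 2 is the failed test and the
    exit jump. *)
Lemma triple_while (Inv : nat -> hst R -> Prop) a b c B K : a < 30 -> b < 30 ->
  (forall j st, j <= B -> Inv j st -> (reg st a < reg st b) = (j < B)) ->
  (forall j, j < B -> triple (Inv j) c K (Inv j.+1)) ->
  triple (Inv 0) (While a b c) ((K + 2) * B + 2) (Inv B).
Proof.
move=> al bl Hc Hb.
suff H d : forall j, j + d = B -> forall st, Inv j st ->
    exists k st', [/\ k <= (K + 2) * d + 2, exec (While a b c) k st st' & Inv B st'].
  by move=> st; apply: H.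
elim: d => [|d IH] j jB st I.
  rewrite addn0 in jB; subst j; exists 2, st; split=> //; first by rewrite muln0.
  by apply: exec_while_false => //; rewrite (Hc B) // ltnn.
have jl : j < B by lia.
have [k1 [s1 [l1 E1 I1]]] := Hb j jl st I.
have [|k2 [s2 [l2 E2 I2]]] := IH j.+1 _ s1 I1; first by lia.
exists (k1 + 2 + k2), s2; split=> //; first by nia.
by apply: exec_while_true E1 E2 => //; rewrite (Hc j) // ltnW.
Qed.

End Semantics.

(** * The vertex orderings *)

Section Tau.
Variables (R : realType) (X : nat -> R * R) (n : nat).

Lemma tau_perm u : u < n -> perm_eq (tau X n u) (iota 0 n).
Proof. by move=> un; rewrite /tau un perm_sort. Qed.

Lemma tau_uniq u : uniq (tau X n u).
Proof.
rewrite /tau; case: ifP => // _.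
by rewrite sort_uniq iota_uniq.
Qed.

Lemma size_tau u : u < n -> size (tau X n u) = n.
Proof. by move=> /tau_perm/perm_size ->; rewrite size_iota. Qed.

Lemma mem_tau u v : u < n -> (v \in tau X n u) = (v < n).
Proof. by move=> /tau_perm/perm_mem ->; rewrite mem_iota add0n. Qed.

Lemma oracle_succ_nth u k : k < size (tau X n u) ->
  oracle_succ X n u (nth n (tau X n u) k) = nth n (tau X n u) k.+1.
Proof. by move=> kl; rewrite /oracle_succ mem_nth // index_uniq // tau_uniq. Qed.

End Tau.

(** * The program *)

Definition cell_key (M k : nat) := (k %/ M) * (k %/ M) + (k %% M) * (k %% M).
Definition disc_count (M s : nat) := count (fun k => cell_key M k <= s) (iota 0 (M * M)).
(** As [disc_count] is monotone in [s], this is the entry of index [k] in the sorted list of keys,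
    and 2 M^2 once [k] reaches M^2. *)
Definition disc_table (M k : nat) :=
  count (fun s => disc_count M s <= k) (iota 0 (M * M + M * M)).

Lemma count_leq_split (f : nat -> nat) j s :
  count (fun k => f k <= j) s = count (fun k => f k < j) s + count (fun k => f k == j) s.
Proof. by elim: s => //= x s ->; case: ltngtP; lia. Qed.

Lemma count_iotaS (f : pred nat) j :
  count f (iota 0 j.+1) = count f (iota 0 j) + f j.
Proof. by rewrite -addn1 iotaD count_cat /= add0n addn0. Qed.

Definition sqrt_init := Block [:: HConst 1 1; HAdd 6 0 1; HConst 2 0; HConst 3 0].
(** Since [0 %/ 0 = 0], dividing [n.+1 - t] by itself is a branch-free test of [t <= n]. Its value,
    with [t] the square of the successor, is added to register 2; [n] rounds suffice to reach the
    integer square root. *)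
Definition sqrt_loop := While 3 0 (Block
  [:: HAdd 17 2 1; HMul 17 17 17; HSub 17 6 17; HDiv 17 17 17; HAdd 2 2 17; HAdd 3 3 1]).

Definition cnt_init := Block [:: HMul 4 2 2; HAdd 5 4 4; HConst 3 0; HConst 13 0].
Definition cnt_loop := While 3 4 (Block
  [:: HDiv 17 3 2; HMul 18 17 2; HSub 18 3 18; HMul 17 17 17; HMul 18 18 18;
      HAdd 17 17 18; HLd 18 0 17; HAdd 18 18 1; HSt 0 17 18; HAdd 3 3 1]).

Definition reset := Block [:: HConst 3 0; HConst 7 0].
(** A counting sort by two prefix sums: those of array 0 are the values of [disc_count], whose
    histogram goes to array 1, and the prefix sums of that histogram form [disc_table]. *)
Definition hist_loop := While 3 5 (Block
  [:: HLd 17 0 3; HAdd 7 7 17; HLd 17 1 7; HAdd 17 17 1; HSt 1 7 17; HAdd 3 3 1]).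
Definition table_loop := While 3 0 (Block
  [:: HLd 17 1 3; HAdd 7 7 17; HSt 2 3 7; HAdd 3 3 1]).

(** Register [l] ends with the last vertex of the list, the farthest one. Register 13 is always
    zero, so [HAdd l 17 13] is a copy. *)
Definition scan (u k l : nat) :=
  Seq (Block [:: HFirst 17 u; HConst 3 0; HConst l 0])
      (While 3 0 (Block [:: HLd 18 2 3; HSt k 17 18; HAdd l 17 13;
                            HSucc 17 u 17; HAdd 3 3 1])).

Ltac run_block :=
  cbv beta iota zeta delta [foldl heval rset updA Nat.eqb reg arr fmem].

Ltac run_block_sym :=
  cbv beta iota zeta delta [foldl heval rset updA]; cbn [reg arr fmem].

(** * Correctness of the table computation and of list traversal *)

Section Tables.
Variables (R : realType) (X : nat -> R * R) (n : nat).
Notation triple := (@triple R X n).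

Definition start_state (st : hst R) :=
  [/\ reg st 0 = n & forall k i, arr st k i = 0].

Definition sqrt_state (st : hst R) :=
  [/\ reg st 0 = n, reg st 1 = 1, reg st 2 * reg st 2 <= n,
      n < (reg st 2).+1 * (reg st 2).+1 & forall k i, arr st k i = 0].

Lemma sqrt_spec :
  triple start_state (Seq sqrt_init sqrt_loop) (8 * n + 6) sqrt_state.
Proof.
(* Register 2 equals the round number until it stops, and it stops only at the integer square
   root. *)
pose Inv j (st : hst R) :=
  [/\ reg st 0 = n, reg st 1 = 1, reg st 6 = n.+1 /\ reg st 3 = j,
      reg st 2 * reg st 2 <= n /\ (reg st 2 = j \/ n < (reg st 2).+1 * (reg st 2).+1)
    & forall k i, arr st k i = 0].
apply: triple_weaken (triple_seq (Q := Inv 0) _ (triple_while (Inv := Inv) (B := n) _ _ _ _)) _ _ => //.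
- apply: triple_block => // -[g A F] [/= H0 HA]; run_block; split=> //=; rewrite ?H0 //.
  + by split=> //; lia.
  + by split=> //; left.
- by move=> j [g A F] jn [/= -> _ [_ ->] _ _].
- move=> j jn; apply: triple_block; [by []|]; move=> [g A F] [/= H0 H1 [H6 H3] [Hl Hr] HA].
  unfold Inv; run_block; rewrite H0 H1 H6 H3 !addn1; split=> //.
  set t := (g 2).+1 * (g 2).+1 in Hr *.
  have tE : (g 2).+1 * (g 2).+1 = t by [].
  clearbody t.
  case: (leqP t n) => tn.
  + rewrite divnn (_ : 0 < n.+1 - t) /=; last by rewrite subn_gt0.
    by rewrite addn1 tE; split=> //; left; case: Hr => [->|]; lia.
  + have -> : n.+1 - t = 0 by lia.
    by rewrite div0n addn0; split=> //; right; rewrite tE.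
- by rewrite /lowers /=; lia.
- move=> st [H0 H1 _ [Hl Hr] HA]; split=> //.
  by case: Hr => // Hr; rewrite Hr; nia.
Qed.

Variable M : nat.
Hypotheses (Mn : M * M <= n) (nM : n < M.+1 * M.+1).

Definition base_state (st : hst R) :=
  [/\ reg st 0 = n, reg st 1 = 1, reg st 2 = M, reg st 4 = M * M & reg st 13 = 0].

Definition cnt_state (st : hst R) :=
  [/\ base_state st, reg st 5 = M * M + M * M,
      forall s, arr st 0 s = count (fun k => cell_key M k == s) (iota 0 (M * M))
    & forall i, arr st 1 i = 0].

Lemma cnt_spec :
  triple sqrt_state (Seq cnt_init cnt_loop) (20 * n + 6) cnt_state.
Proof.
pose Inv j (st : hst R) :=
  [/\ base_state st, reg st 5 = M * M + M * M, reg st 3 = j,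
      forall s, arr st 0 s = count (fun k => cell_key M k == s) (iota 0 j)
    & forall i, arr st 1 i = 0].
apply: triple_weaken (triple_seq (Q := Inv 0) _ (triple_while (Inv := Inv) (B := M * M) _ _ _ _)) _ _ => //.
- apply: triple_block; [by []|]; move=> [g A F] [/= H0 H1 Hl Hr HA].
  have HM : g 2 = M by nia.
  by unfold Inv, base_state; run_block; rewrite HM; split.
- by move=> j [g A F] jn [[/= _ _ _ -> _] _ ->].
- move=> j jn; apply: triple_block; [by []|]; move=> [g A F] [[/= H0 H1 H2 H4 H13] H5 H3 HA HB].
  unfold Inv, base_state.
  run_block.
  rewrite H0.
  rewrite H1.
  rewrite H2.
  rewrite H3.
  rewrite (addn1 j).
  split; [by []|by []|by []| |by []].
  move=> s; rewrite count_iotaS.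
  rewrite -HA /cell_key /upd -(_ : j - j %/ M * M = j %% M); last first.
    by rewrite {1}(divn_eq j M) addKn.
  by case: eqP => [->|/eqP ne]; rewrite ?eqxx // eq_sym (negbTE ne) addn0.
- by rewrite /lowers /=; nia.
- by move=> st [? ? ? ? ?]; split.
Qed.

Definition hist_state (st : hst R) :=
  base_state st /\ forall l, arr st 1 l =
    count (fun s => disc_count M s == l) (iota 0 (M * M + M * M)).

Lemma hist_spec : triple cnt_state (Seq reset hist_loop) (40 * n + 4) hist_state.
Proof.
pose Inv j (st : hst R) :=
  [/\ base_state st /\ reg st 5 = M * M + M * M, reg st 3 = j,
      reg st 7 = count (fun k => cell_key M k < j) (iota 0 (M * M)),
      forall s, arr st 0 s = count (fun k => cell_key M k == s) (iota 0 (M * M))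
    & forall l, arr st 1 l = count (fun s => disc_count M s == l) (iota 0 j)].
apply: triple_weaken (triple_seq (Q := Inv 0) _ (triple_while (Inv := Inv) (B := M * M + M * M) _ _ _ _)) _ _ => //.
- apply: triple_block; [by []|]; move=> [g A F] [[H0 H1 H2 H4 H13] H5 HA HB].
  unfold Inv, base_state; run_block; split=> //.
  by rewrite (eq_count (a2 := pred0)) ?count_pred0.
- by move=> j [g A F] jn [[_ /= ->] ->].
- move=> j jn; apply: triple_block; [by []|]; move=> [g A F] [[[/= H0 H1 H2 H4 H13] H5] H3 H7 HA HB].
  unfold Inv, base_state; run_block.
  have E : g 7 + A 0 (g 3) = disc_count M j by rewrite H7 H3 HA -count_leq_split.
  rewrite E H3 H1 addn1; split=> // l.
  rewrite count_iotaS -HB /upd.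
  by case: eqP => [->|/eqP ne]; rewrite ?eqxx // eq_sym (negbTE ne) addn0.
- by rewrite /lowers /=; nia.
- by move=> st [[? ?] ? ? ? ?]; split.
Qed.

Definition table_state (st : hst R) :=
  base_state st /\ forall k, k < n -> arr st 2 k = disc_table M k.

Lemma table_spec : triple hist_state (Seq reset table_loop) (14 * n + 4) table_state.
Proof.
pose Inv j (st : hst R) :=
  [/\ base_state st, reg st 3 = j,
      reg st 7 = count (fun s => disc_count M s < j) (iota 0 (M * M + M * M)),
      forall l, arr st 1 l = count (fun s => disc_count M s == l) (iota 0 (M * M + M * M))
    & forall k, k < j -> arr st 2 k = disc_table M k].
apply: triple_weaken (triple_seq (Q := Inv 0) _ (triple_while (Inv := Inv) (B := n) _ _ _ _)) _ _ => //.
- apply: triple_block; [by []|]; move=> [g A F] [[H0 H1 H2 H4 H13] HB].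
  unfold Inv, base_state; run_block; split=> //.
  by rewrite (eq_count (a2 := pred0)) ?count_pred0.
- by move=> j [g A F] jn [[/= -> _ _ _ _] ->].
- move=> j jn; apply: triple_block; [by []|]; move=> [g A F] [[/= H0 H1 H2 H4 H13] H3 H7 HB HC].
  unfold Inv, base_state; run_block.
  have E : g 7 + A 1 (g 3) = disc_table M j by rewrite H7 H3 HB -count_leq_split.
  rewrite E H3 H1 addn1; split=> // k kj.
  by rewrite /upd; case: eqP => [->//|ne]; apply: HC; lia.
- by rewrite /lowers /=; lia.
- by move=> st [? ? ? ? ?]; split.
Qed.

Definition frame (l k : nat) (st0 st : hst R) :=
  (forall r, r \notin [:: 3; 17; 18; l] -> reg st r = reg st0 r) /\
  (forall k', k' != k -> arr st k' = arr st0 k').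

Lemma scan_spec u k l st0 : table_state st0 -> size (tau X n (reg st0 u)) = n ->
  u < 30 -> l < 30 -> k < 8 -> k != 2 ->
  u \notin [:: 3; 17; 18; l] -> l \notin [:: 0; 1; 2; 3; 4; 13; 17; 18] ->
  let s := tau X n (reg st0 u) in
  triple (eq st0) (scan u k l) (17 * n + 5)
    (fun st => [/\ table_state st, frame l k st0 st, reg st l = last 0 s &
       forall v, v \in s -> arr st k v = disc_table M (index v s)]).
Proof.
move=> T0 sz ul ll kl k2 uin lin s.
have us : uniq s by exact: tau_uniq.
have [l0 l1 l2 l3 l4] : [/\ (0 == l) = false, (1 == l) = false, (2 == l) = false,
   (3 == l) = false & (4 == l) = false].
  by move: lin; rewrite !inE; split; lia.
have [l13 l17 l18] : [/\ (13 == l) = false, (17 == l) = false & (18 == l) = false].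
  by move: lin; rewrite !inE; split; lia.
have [u3 u17 u18 ueql] : [/\ (u == 3) = false, (u == 17) = false, (u == 18) = false & (u == l) = false].
  by move: uin; rewrite !inE; split; lia.
pose Inv j (st : hst R) :=
  [/\ table_state st, frame l k st0 st, reg st 3 = j /\ reg st 17 = nth n s j,
      reg st l = last 0 (take j s) &
      forall v, v \in take j s -> arr st k v = disc_table M (index v s)].
apply: triple_weaken (triple_seq (Q := Inv 0) _ (triple_while (Inv := Inv) (B := n) _ _ _ _)) _ _ => //.
- apply: triple_block => [|st <-]; first by rewrite /= ul ll.
  case: T0 => [[/= H0 H1 H2 H4 H13] HT].
  unfold Inv, table_state, base_state, frame; run_block_sym. rewrite !nat_eqbE ?eqxx /=.
  rewrite ?l0 ?l1 ?l2 ?l3 ?l4 ?l13 ?l17 take0; split=> //.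
  split=> // r; rewrite !inE !negb_or => /and4P[/negbTE r3 /negbTE r17 _ /negbTE rl].
  by rewrite !nat_eqbE rl r3 r17.
- by move=> j [g A F] jn [[[/= -> _ _ _ _] _] _ [-> _] _ _].
- move=> j jn; apply: triple_block => [|st].
    by rewrite /= ul ll kl.
  case: st => g A F [[[/= H0 H1 H2 H4 H13] HT] [Fr Fa] [H3 H17] Hl HA].
  have ju : g u = reg st0 u by exact: (Fr u).
  have k2E : Nat.eqb 2 k = false by rewrite nat_eqbE eq_sym (negbTE k2).
  unfold Inv, table_state, base_state, frame; run_block_sym.
  rewrite !nat_eqbE ?l0 ?l1 ?l2 ?l3 ?l4 ?l13 ?l17 ?l18 ?u3 ?u17 ?u18 ?ueql ?eqxx /=.
  rewrite ?(eq_sym l) ?l0 ?l1 ?l2 ?l3 ?l4 ?l13 ?l17 ?l18.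
  rewrite H0 H1 H2 H4 H13 H3 H17 ju /=.
  (* After the last vertex the oracle returns the default [n], which is also [nth n s n], so the
     invariant on register 17 survives the final round. *)
  rewrite oracle_succ_nth ?sz // addn0 addn1 HT //.
  rewrite (take_nth n) ?sz // last_rcons ?eqxx.
  split=> //.
  + by split=> // i il; rewrite eq_sym (negbTE k2) HT.
  + split=> [r|k' k'k].
    * move=> rin; have := rin; rewrite !inE !negb_or => /and4P[/negbTE r3 /negbTE r17 /negbTE r18 /negbTE rl].
      by rewrite !nat_eqbE rl r3 r17 r18; exact: (Fr r rin).
    * by rewrite nat_eqbE (negbTE k'k); exact: (Fa k' k'k).
  + move=> v; rewrite mem_rcons inE /upd; case: eqVneq => [-> _|vn /= vin].
      by rewrite index_uniq // sz.
    exact: HA.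
- by rewrite /lowers /=; lia.
- move=> st [T Fr _ Hl HA]; split=> //.
    by rewrite Hl take_oversize ?sz.
  by move=> v vs; apply: HA; rewrite take_oversize ?sz.
Qed.

End Tables.

(** Register 10 becomes [b * j + (1 - b) * old], where the bit [b] is the product of the two tests
    of [far]. *)
Definition find_far := Seq
  (Block [:: HConst 3 0; HConst 10 0; HConst 20 9; HMul 20 20 4; HConst 21 10])
  (While 3 0 (Block
    [:: HLd 17 3 3; HMul 17 17 21; HAdd 17 17 1; HSub 17 17 20; HDiv 17 17 17;
        HLd 18 4 3; HMul 18 18 21; HAdd 18 18 1; HSub 18 18 20; HDiv 18 18 18;
        HMul 17 17 18; HMul 18 17 3; HSub 19 1 17; HMul 10 10 19; HAdd 10 10 18;
        HAdd 3 3 1])).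

(* Real memory is both scratch space and output area, so the coordinates are
   first staged at the addresses [2 n + 2 + j]. *)
Definition emit := Seq
  (Block [:: HConst 3 0; HConst 20 127; HMul 20 20 4; HAdd 20 20 1; HConst 21 100;
             HAdd 22 2 2; HAdd 23 0 0; HAdd 23 23 1; HAdd 23 23 1])
  (While 3 0 (Seq (Seq
    (Block
    [:: HLd 24 3 3; HLd 25 4 3; HLd 26 5 3; HLd 27 6 3;
        HMul 14 24 21; HSub 14 20 14; HDiv 14 14 14;
        HMul 15 26 21; HSub 15 20 15; HDiv 15 15 15;
        HMul 16 27 21; HSub 16 20 16; HDiv 16 16 16])
    (Block
    [:: HMul 17 14 15; HSub 18 1 17;
        HMul 19 17 24; HMul 28 18 27; HAdd 19 19 28;
        HMul 29 17 26; HMul 28 18 25; HAdd 29 29 28;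
        HFromN 0 19; HFromN 1 29; HRSub 0 0 1; HFromN 1 22; HRDiv 0 0 1;
        HAdd 28 3 3; HAdd 28 28 23; HRStore 28 0]))
    (Block
    [:: HMul 17 14 16; HSub 18 1 17;
        HMul 19 17 24; HMul 28 18 26; HAdd 19 19 28;
        HMul 29 17 27; HMul 28 18 25; HAdd 29 29 28;
        HFromN 0 19; HFromN 1 29; HRSub 0 0 1; HFromN 1 22; HRDiv 0 0 1;
        HAdd 28 3 3; HAdd 28 28 23; HAdd 28 28 1; HRStore 28 0; HAdd 3 3 1]))).

(** The copy runs downwards because real cell 0 is both its scratch cell and the first output cell,
    which must be written last. *)
Definition copy_back := Seq
  (Block [:: HAdd 20 0 0; HConst 3 0])
  (While 3 20 (Block
    [:: HAdd 3 3 1; HSub 17 20 3; HAdd 18 17 23; HRLoad 0 18; HRStore 17 0])).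

Definition build_table :=
  Seq (Seq sqrt_init sqrt_loop) (Seq (Seq cnt_init cnt_loop)
    (Seq (Seq reset hist_loop) (Seq reset table_loop))).

Definition find_corners :=
  Seq (scan 13 7 8) (Seq (scan 8 3 9) (Seq (scan 9 4 14) (Seq find_far
    (Seq (scan 10 7 11) (Seq (scan 11 5 12) (scan 12 6 14)))))).

Definition embed := Seq build_table (Seq find_corners (Seq emit copy_back)).

Definition embed_prog : seq instr := code 0 embed ++ [:: Halt].

(** Four thresholds are kept apart by gaps that exceed the total error, at most M^2 / 100. Keys for
    the corners of the point's own side are at most 1.25 M^2; the program tests estimates at 1.27
    M^2; estimates are accurate for keys up to 1.28 M^2; [disc_count_growth] holds up to 1.3 M^2. *)
Definition near (M s : nat) := 100 * s <= 127 * (M * M).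
(** For the cell index i one has i^2 - (M-1-i)^2 = (M-1) (2i - (M-1)), so the quotient by 2 M is
    nearly the coordinate relative to the centre. [p], [q] belong to the two corners of one side,
    [p'], [q'] to those of the opposite side, in the same order. *)
Definition coord (R : realType) (M p q p' q' : nat) : R :=
  ((if near M p && near M q then p%:R - q%:R else p'%:R - q'%:R) / (M + M)%:R)%R.

Definition estimate (R : realType) (X : nat -> R * R) (n M u v : nat) :=
  disc_table M (index v (tau X n u)).

(** When [a] and [b] are near opposite corners, the other two corners are at squared distance about
    M^2 from both; 0.9 leaves room for errors. *)
Definition far (R : realType) (X : nat -> R * R) (n M a b v : nat) :=
  (9 * (M * M) <= 10 * estimate X n M a v) && (9 * (M * M) <= 10 * estimate X n M b v).

Definition farthest (R : realType) (X : nat -> R * R) (n u : nat) := last 0 (tau X n u).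

(* As [0 %/ 0 = 0], the quotient [x %/ x] computes the tests without branching. *)
Lemma indicator_div a b : (a.+1 - b) %/ (a.+1 - b) = (b <= a).
Proof. by rewrite divnn subn_gt0 ltnS. Qed.

(** * Correctness of the search for the corners *)

Section Embedding.
Variables (R : realType) (X : nat -> R * R) (n : nat).
Notation triple := (@triple R X n).

Lemma triple_pre (P : hst R -> Prop) c K Q :
  (forall st, P st -> triple (eq st) c K Q) -> triple P c K Q.
Proof. by move=> H st p; exact: (H st p st). Qed.

Variable M : nat.
Hypotheses (Mn : M * M <= n) (nM : n < M.+1 * M.+1).
Notation base_state := (@base_state R n M).
Notation table_state := (@table_state R n M).
Notation est := (estimate X n M).
Notation last_of := (farthest X n).

(** True of every vertex and, for [n = 0], of every number, so the empty instance needs no separate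
    treatment of the program. *)
Definition listed u := size (tau X n u) = n.

Lemma listed0 : listed 0.
Proof.
rewrite /listed; case: (posnP n) => n0; last exact: size_tau.
by rewrite /tau n0.
Qed.

Lemma listed_lt u : 0 < n -> listed u -> u < n.
Proof. by rewrite /listed /tau; case: ifP => //= _; lia. Qed.

Lemma listed_farthest u : listed u -> listed (last_of u).
Proof.
move=> lu; case: (posnP n) => n0.
  by rewrite /farthest /tau n0 ltn0 /=; exact: listed0.
have un := listed_lt n0 lu.
apply: size_tau; rewrite -(mem_tau X _ un) /farthest.
move: lu; rewrite /listed; case: (tau X n u) => [|x s _ /=]; first by move=> /= ?; lia.
exact: mem_last.
Qed.

Definition estimated u (st : hst R) k := forall v, v < n -> arr st k v = est u v.

Lemma scan_estimated u k l st0 : table_state st0 -> listed (reg st0 u) ->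
  u < 30 -> l < 30 -> k < 8 -> k != 2 ->
  u \notin [:: 3; 17; 18; l] -> l \notin [:: 0; 1; 2; 3; 4; 13; 17; 18] ->
  triple (eq st0) (scan u k l) (17 * n + 5)
    (fun st => [/\ table_state st, frame l k st0 st, reg st l = last_of (reg st0 u) &
       estimated (reg st0 u) st k]).
Proof.
move=> T0 lu ul ll kl k2 uin lin.
have H := scan_spec Mn nM T0 lu ul ll kl k2 uin lin.
apply: triple_weaken H _ _ => // st [T Fr Hl HA].
split=> // v vn; apply: HA; rewrite mem_tau //.
by apply: listed_lt lu; lia.
Qed.

Let a := last_of 0.
Let b := last_of a.

Definition near_scanned (st : hst R) :=
  [/\ table_state st, estimated a st 3 & estimated b st 4].

(** The program is specified on every input, so farness is only conditional: if no vertex is far,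
    register 10 keeps its initial value 0. *)
Definition far_vertex z := [/\ listed z,
  (0 < n -> z < n) & (exists2 v, v < n & far X n M a b v) -> far X n M a b z].

Lemma find_far_spec :
  triple near_scanned find_far (34 * n + 7)
    (fun st => near_scanned st /\ far_vertex (reg st 10)).
Proof.
pose Inv j (st : hst R) :=
  [/\ near_scanned st, reg st 3 = j, reg st 20 = 9 * (M * M), reg st 21 = 10 &
   (reg st 10 = 0 \/ reg st 10 < n) /\
   ((exists2 v, v < j & far X n M a b v) -> far X n M a b (reg st 10))].
apply: triple_weaken (triple_seq (Q := Inv 0) _ (triple_while (Inv := Inv) (B := n) _ _ _ _)) _ _ => //.
- apply: triple_block; [by []|]; move=> [g A F] [[[/= H0 H1 H2 H4 H13] HT] Ha Hb].
  unfold Inv, near_scanned, table_state, base_state; run_block; rewrite H4.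
  by split=> //; split; [left | case].
- by move=> j [g A F] jn [[[[/= -> _ _ _ _] _] _ _] -> _ _ _].
- move=> j jn; apply: triple_block; [by []|]; move=> [g A F].
  unfold Inv, near_scanned, table_state, base_state; run_block.
  move=> [[[[H0 H1 H2 H4 H13] HT] Ha Hb] H3 H20 H21 [Hz Hf]].
  rewrite H1 H3 H20 H21 (addn1 j) !addn1 !indicator_div mulnb !(mulnC _ 10).
  have -> : A 3 j = est a j by exact: Ha.
  have -> : A 4 j = est b j by exact: Hb.
  rewrite -/(far X n M a b j).
  split=> //; case: (boolP (far X n M a b j)) => fj.
  + by rewrite muln0 mul1n add0n; split; [right|].
  + rewrite subn0 muln1 mul0n addn0; split=> // -[v vj fv].
    apply: Hf; exists v => //; rewrite ltn_neqAle -ltnS vj andbT.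
    by apply: contraNneq fj => <-.
- by rewrite /lowers /=; nia.
- move=> st [S _ _ _ [Hz Hf]]; split=> //; split=> //.
  + case: Hz => [->|zn]; [exact: listed0 | exact: size_tau].
  + by move=> n0; case: Hz => [->|].
Qed.

Definition all_scanned z (st : hst R) :=
  [/\ near_scanned st, estimated (last_of z) st 5 &
      estimated (last_of (last_of z)) st 6].

Lemma find_corners_spec :
  triple table_state find_corners (200 * n + 50)
    (fun st => exists2 z, far_vertex z & all_scanned z st).
Proof.
pose Q1 (st : hst R) := table_state st /\ reg st 8 = a.
pose Q2 (st : hst R) := [/\ table_state st, reg st 9 = b & estimated a st 3].
pose Q4 (st : hst R) := near_scanned st /\ far_vertex (reg st 10).
pose Q5 (st : hst R) := exists2 z, far_vertex z & near_scanned st /\ reg st 11 = last_of z.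
pose Q6 (st : hst R) := exists2 z, far_vertex z &
  [/\ near_scanned st, reg st 12 = last_of (last_of z) & estimated (last_of z) st 5].
have la : listed a by exact/listed_farthest/listed0.
have lb : listed b by exact/listed_farthest.
apply: (@triple_weaken R X n table_state _ _ _ (fun st => exists2 z, far_vertex z & all_scanned z st) _
  (triple_seq (Q := Q1) _ (triple_seq (Q := Q2) _ (triple_seq (Q := near_scanned) _
    (triple_seq (Q := Q4) find_far_spec (triple_seq (Q := Q5) _ (triple_seq (Q := Q6) _ _))))))) => //.
- apply: triple_pre => st0 T0.
  have z0 : reg st0 13 = 0 by case: T0 => [[]].
  apply: triple_weaken (scan_estimated (u := 13) (k := 7) (l := 8) T0 _ _ _ _ _ _ _) _ _ => //.
    by rewrite z0; exact: listed0.
  by move=> st [T _ Hl _]; split=> //; rewrite Hl z0.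
- apply: triple_pre => st0 [T0 H8].
  apply: triple_weaken (scan_estimated (u := 8) (k := 3) (l := 9) T0 _ _ _ _ _ _ _) _ _ => //.
    by rewrite H8.
  by rewrite H8 => st [T _ Hl HA]; split.
- apply: triple_pre => st0 [T0 H9 Ha].
  apply: triple_weaken (scan_estimated (u := 9) (k := 4) (l := 14) T0 _ _ _ _ _ _ _) _ _ => //.
    by rewrite H9.
  rewrite H9 => st [T [_ Fa] Hl HA]; split=> // v vn.
  by rewrite Fa // Ha.
- apply: triple_pre => st0 [[T0 Ha Hb] Z].
  have lz : listed (reg st0 10) by case: Z.
  apply: triple_weaken (scan_estimated (u := 10) (k := 7) (l := 11) T0 _ _ _ _ _ _ _) _ _ => //.
  move=> st [T [_ Fa] Hl HA]; exists (reg st0 10); first exact: Z.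
  split; last exact: Hl.
  by split=> [|v vn|v vn]; [exact: T | rewrite Fa // Ha | rewrite Fa // Hb].
- apply: triple_pre => st0 [z Z [[T0 Ha Hb] H11]].
  have lz : listed z by case: Z.
  apply: triple_weaken (scan_estimated (u := 11) (k := 5) (l := 12) T0 _ _ _ _ _ _ _) _ _ => //.
    by rewrite H11; exact: listed_farthest.
  rewrite H11 => st [T [_ Fa] Hl HA]; exists z; first exact: Z.
  split; [|exact: Hl|exact: HA].
  by split=> [|v vn|v vn]; [exact: T | rewrite Fa // Ha | rewrite Fa // Hb].
- apply: triple_pre => st0 [z Z [[T0 Ha Hb] H12 Hc]].
  have lz : listed z by case: Z.
  apply: triple_weaken (scan_estimated (u := 12) (k := 6) (l := 14) T0 _ _ _ _ _ _ _) _ _ => //.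
    by rewrite H12; exact/listed_farthest/listed_farthest.
  rewrite H12 => st [T [_ Fa] Hl HA]; exists z; first exact: Z.
  split; [|by move=> v vn; rewrite Fa // Hc|exact: HA].
  by split=> [|v vn|v vn]; [exact: T | rewrite Fa // Ha | rewrite Fa // Hb].
- by lia.
Qed.

End Embedding.

Lemma upd_same (A : Type) (f : nat -> A) k x : upd f k x k = x.
Proof. by rewrite /upd eqxx. Qed.

Lemma upd_other (A : Type) (f : nat -> A) k x j : j != k -> upd f k x j = f j.
Proof. by rewrite /upd => /negbTE ->. Qed.

(** * Correctness of the output phase *)

Section Output.
Variables (R : realType) (X : nat -> R * R) (n M : nat).
Notation triple := (@triple R X n).

(** The selection happens on natural numbers and the subtraction on reals, because the difference
    may be negative. *)
Lemma coord_select (b1 b2 : bool) p q p' q' :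
  (((b1 * b2 * p + (1 - b1 * b2) * p')%N%:R - (b1 * b2 * q + (1 - b1 * b2) * q')%N%:R) / (M + M)%N%:R)%R
  = ((if b1 && b2 then p%:R - q%:R else p'%:R - q'%:R) / (M + M)%N%:R)%R :> R.
Proof. by case: b1; case: b2; rewrite /= ?mul0n ?mul1n ?addn0. Qed.

Variables sA sB sC sD : nat -> nat.
Let xc v : R := coord R M (sA v) (sC v) (sD v) (sB v).
Let yc v : R := coord R M (sA v) (sD v) (sC v) (sB v).
Let base := n + n + 1 + 1.

Definition input_state (st : hst R) :=
  [/\ reg st 0 = n, reg st 1 = 1, reg st 2 = M & reg st 4 = M * M] /\
  forall v, v < n ->
    [/\ arr st 3 v = sA v, arr st 4 v = sB v, arr st 5 v = sC v & arr st 6 v = sD v].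

Definition staged j (F : nat -> R) :=
  forall v, v < j -> F (v + v + base) = xc v /\ F (v + v + base + 1) = yc v.

Lemma staged_upd j F a x : a < 2 \/ j + j + base <= a -> staged j F -> staged j (upd F a x).
Proof.
move=> ha S v vj; have [<- <-] := S v vj.
by rewrite !upd_other //; rewrite /base; apply/eqP; case: ha; lia.
Qed.

Lemma stagedS j F : staged j F -> F (j + j + base) = xc j ->
  F (j + j + base + 1) = yc j -> staged j.+1 F.
Proof.
move=> S Fx Fy v; rewrite ltnS leq_eqVlt => /orP[/eqP ->|vj]; first by rewrite Fx Fy.
exact: S.
Qed.

Lemma emit_spec :
  triple input_state emit (102 * n + 11)
    (fun st => [/\ reg st 0 = n, reg st 1 = 1, reg st 23 = base & staged n (fmem st)]).
Proof.
pose Inv j (st : hst R) :=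
  [/\ input_state st, reg st 3 = j,
      [/\ reg st 20 = 127 * (M * M) + 1, reg st 21 = 100 & reg st 22 = M + M],
      reg st 23 = base & staged j (fmem st)].
pose Mid (P : nat -> (nat -> R) -> Prop) j (st : hst R) :=
  [/\ input_state st, reg st 3 = j,
      [/\ reg st 20 = 127 * (M * M) + 1, reg st 21 = 100 & reg st 22 = M + M],
      reg st 23 = base /\ P j (fmem st) &
      [/\ reg st 24 = sA j, reg st 25 = sB j, reg st 26 = sC j & reg st 27 = sD j] /\
      [/\ reg st 14 = near M (sA j), reg st 15 = near M (sC j) & reg st 16 = near M (sD j)]].
pose half j F := staged j F /\ F (j + j + base) = xc j.
apply: triple_weaken (triple_seq (Q := Inv 0) _ (triple_while (Inv := Inv) (B := n) _ _ _ _)) _ _.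
- apply: triple_block; [by []|]; move=> [g A F].
  unfold Inv, input_state; run_block; move=> [[H0 H1 H2 H4] HA].
  by rewrite H0 H1 H2 H4; split.
- by [].
- by [].
- by move=> j [g A F] jn; unfold Inv, input_state; run_block => -[[[-> _ _ _] _] -> _ _ _].
- move=> j jn.
  apply: triple_seq (triple_seq (Q := Mid staged j) _ (_ : triple _ _ _ (Mid half j))) _.
  + apply: triple_block; [by []|]; move=> [g A F].
    unfold Inv, Mid, input_state; run_block.
    move=> [[[H0 H1 H2 H4] HA] H3 [H20 H21 H22] H23 HS].
    have [A3 A4 A5 A6] := HA j jn.
    rewrite H3 H20 H21 A3 A4 A5 A6 addn1 !indicator_div !(mulnC _ 100).
    by split.
  + apply: triple_block; [by []|]; move=> [g A F].
    unfold Mid, input_state; run_block.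
    move=> [[[H0 H1 H2 H4] HA] H3 [H20 H21 H22] [H23 HS] [[H24 H25 H26 H27] [H14 H15 H16]]].
    split; [by split| by [] | by [] | | by split].
    split=> //; rewrite !H3 !H23 !H24 !H25 !H26 !H27 !H14 !H15 !H1 !H22.
    rewrite /half; split.
      by apply: staged_upd; [right | do 5![apply: staged_upd; first by left]].
    by rewrite /xc /coord -coord_select /upd /= eqxx.
  + apply: triple_block; [by []|]; move=> [g A F].
    unfold Inv, Mid, input_state; run_block.
    move=> [[[H0 H1 H2 H4] HA] H3 [H20 H21 H22] [H23 [HS HX]] [[H24 H25 H26 H27] [H14 H15 H16]]].
    rewrite !H3 !H23 !H24 !H25 !H26 !H27 !H14 !H16 !H1 !H22 (addn1 j).
    split; [by split| by [] | by [] | by [] |].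
    apply: stagedS.
    * apply: staged_upd; first by right; rewrite /base; lia.
      by do 5![apply: staged_upd; first by left].
    * by rewrite !upd_other // /base; lia.
    * by rewrite /yc /coord -coord_select /upd /= eqxx.
- by rewrite /lowers /=; lia.
- unfold Inv, input_state.
  by move=> st [[[H0 H1 _ _] _] _ _ H23 HS]; split.
Qed.

Lemma copy_spec (o : nat -> R) :
  triple (fun st => [/\ reg st 0 = n, reg st 1 = 1, reg st 23 = base &
            forall j, j < n + n -> fmem st (j + base) = o j])
    copy_back (14 * n + 4)
    (fun st => forall j, j < n + n -> fmem st j = o j).
Proof.
pose Inv i (st : hst R) :=
  [/\ [/\ reg st 0 = n, reg st 1 = 1, reg st 23 = base & reg st 20 = n + n],
      reg st 3 = i, forall j, j < n + n -> fmem st (j + base) = o j &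
      forall j, n + n - i <= j < n + n -> fmem st j = o j].
apply: triple_weaken (triple_seq (Q := Inv 0) _ (triple_while (Inv := Inv) (B := n + n) _ _ _ _)) _ _.
- apply: triple_block; [by []|]; move=> [g A F].
  unfold Inv; run_block; move=> [H0 H1 H23 HF]; rewrite H0.
  by split=> // j; lia.
- by [].
- by [].
- by move=> j [g A F] jn; unfold Inv; run_block => -[[_ _ _ ->] -> _ _].
- move=> i il; apply: triple_block; [by []|]; move=> [g A F].
  unfold Inv; run_block; move=> [[H0 H1 H23 H20] H3 HF HO].
  rewrite H0 H1 H23 H20 H3 addn1; split=> // j hj.
  + by rewrite !upd_other ?HF // /base; lia.
  + case: (eqVneq j (n + n - i.+1)) => [->|jne].
      by rewrite !upd_same HF //; lia.
    rewrite upd_other // upd_other ?HO //; lia.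
- by rewrite /lowers /=; lia.
- by unfold Inv => st [_ _ _ H] j jn; apply: H; lia.
Qed.

End Output.

(** * The whole program *)

Section Main.
Variables (R : realType) (X : nat -> R * R) (n M : nat).
Hypotheses (Mn : M * M <= n) (nM : n < M.+1 * M.+1).

Lemma build_table_spec :
  triple X n (@start_state R n) build_table (82 * n + 20) (@table_state R n M).
Proof.
apply: triple_weaken (triple_seq (@sqrt_spec R X n) (triple_seq (cnt_spec X Mn nM)
  (triple_seq (hist_spec X Mn nM) (table_spec X Mn nM)))) _ _ => //.
by lia.
Qed.

Lemma embed_spec : exists k N F, [/\ k <= 500 * n + 500,
  run embed_prog X n k (init R n) = Config (size (code 0 embed)) N F &
  exists2 z, far_vertex X n M z &
    let est := estimate X n M in
    let a := farthest X n 0 in let b := farthest X n a in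
    let c := farthest X n z in let d := farthest X n c in
    forall v, v < n -> (F (2 * v), F (2 * v).+1) =
      (coord R M (est a v) (est c v) (est d v) (est b v),
       coord R M (est a v) (est d v) (est c v) (est b v))].
Proof.
pose st0 := Hst (rset (fun=> 0) 0 n) (fun _ _ => 0) (fun=> 0%R : R).
have S0 : start_state n st0 by [].
have H : triple X n (@start_state R n) embed (500 * n + 500) (fun st =>
  exists2 z, far_vertex X n M z &
    let est := estimate X n M in
    let a := farthest X n 0 in let b := farthest X n a in
    let c := farthest X n z in let d := farthest X n c in
    forall v, v < n -> (fmem st (2 * v), fmem st (2 * v).+1) =
      (coord R M (est a v) (est c v) (est d v) (est b v),
       coord R M (est a v) (est d v) (est c v) (est b v))).
  apply: triple_weaken (triple_seq build_table_spec (triple_seq (find_corners_spec X Mn nM)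
    (_ : triple X n _ _ (116 * n + 15) _))) _ (fun _ x => x); last by lia.
  apply: triple_pre => st1 [z Z [[[[H0 H1 H2 H4 H13] _] Ha Hb] Hc Hd]].
  pose e := estimate X n M; pose a := farthest X n 0; pose c := farthest X n z.
  pose b := farthest X n a; pose d := farthest X n c.
  pose o j := (if odd j then coord R M (e a j./2) (e d j./2) (e c j./2) (e b j./2)
               else coord R M (e a j./2) (e c j./2) (e d j./2) (e b j./2))%R.
  have He := @emit_spec R X n M (e a) (e b) (e c) (e d).
  have Hcp := @copy_spec R X n o.
  have I1 : input_state n M (e a) (e b) (e c) (e d) st1.
    split=> // v vn; split; [exact: Ha | exact: Hb | exact: Hc | exact: Hd].
  have {}He : triple X n (eq st1) emit (102 * n + 11) (fun st =>
      [/\ reg st 0 = n, reg st 1 = 1, reg st 23 = n + n + 1 + 1 &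
            forall j, j < n + n -> fmem st (j + (n + n + 1 + 1)) = o j]).
    move=> st <-; have [k [st' [kl E [K0 K1 K23 Ks]]]] := He st1 I1.
    exists k, st'; split=> //; split=> // j jn.
    have [|E0 E1] := Ks j./2; first by lia.
    rewrite /o; case: ifP => oj.
      by rewrite -E1; congr fmem; lia.
    by rewrite -E0; congr fmem; lia.
  apply: triple_weaken (triple_seq He Hcp) _ _; first by lia.
  move=> st Hs; exists z => // est0 a0 b0 c0 d0 v vn.
  rewrite !Hs; try lia.
  by rewrite /o /= mul2n odd_double doubleK uphalf_double.
have [k [st' [kl E Hs]]] := H _ S0.
have [|//|N EN _] := E embed_prog 0 (upd (fun=> 0) 0 n).
- by move=> j jl; rewrite /embed_prog add0n nth_cat jl.
- by split=> [[|r] _|i j jl] //=; rewrite upd_other //; lia.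
by exists k, N, (fmem st').
Qed.

End Main.

(** * Lattice points in a quarter disc *)

(** A downward closed predicate holds exactly on an initial segment, and the count is its length. *)
Lemma count_initial (p : pred nat) m j : (forall i, p i.+1 -> p i) ->
  j < m -> (j < count p (iota 0 m)) = p j.
Proof.
move=> dec; have mono i k : i <= k -> p k -> p i.
  by move=> /subnK <-; elim: (k - i) => // d IH /dec.
elim: m => // m IH; rewrite ltnS count_iotaS => jm.
have cm : count p (iota 0 m) <= m by rewrite -{2}(size_iota 0 m) count_size.
have full : p m -> count p (iota 0 m) = m.
  move=> pm; rewrite -[RHS](size_iota 0 m); apply/eqP; rewrite -all_count.
  by apply/allP => i; rewrite mem_iota => /andP[_ im]; apply: mono pm; apply: ltnW.
move: jm; rewrite leq_eqVlt => /orP[/eqP -> |jm]; case: (boolP (p m)) => pm.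
- by rewrite full // addn1 ltnS leqnn.
- by rewrite addn0 ltnNge cm.
- by rewrite full // addn1 ltnS (ltnW jm); apply/esym; apply: mono pm; exact: ltnW.
- by rewrite addn0 IH.
Qed.

Definition row_count (M i s : nat) := count (fun j => i * i + j * j <= s) (iota 0 M).

Lemma disc_count_rows M s : disc_count M s = \sum_(0 <= i < M) row_count M i s.
Proof.
rewrite /disc_count.
suff H k : count (fun k => cell_key M k <= s) (iota 0 (k * M)) =
           \sum_(0 <= i < k) row_count M i s by exact: H.
elim: k => [|k IH]; first by rewrite mul0n big_nil.
rewrite big_nat_recr //= -IH mulSnr iotaD count_cat add0n; congr (_ + _).
rewrite -[in iota (k * M) M](addn0 (k * M)) iotaDl count_map.
apply: eq_in_count => j; rewrite mem_iota => /andP[_ jM] /=.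
have M0 : 0 < M by lia.
by rewrite /cell_key divnMDl // modnMDl divn_small // modn_small // addn0.
Qed.

Lemma row_count_mono M i s s' : s <= s' -> row_count M i s <= row_count M i s'.
Proof. by move=> ss; apply: sub_count => j /= /leq_trans; exact. Qed.

Lemma disc_count_mono M s s' : s <= s' -> disc_count M s <= disc_count M s'.
Proof. by move=> ss; apply: sub_count => j /= /leq_trans; exact. Qed.

Lemma disc_count_le M s : disc_count M s <= M * M.
Proof. by rewrite -[leqRHS](size_iota 0) count_size. Qed.

(** Let x and y count the cells of row i in the discs of s and s'. For x > 0, s' - s < y^2 - (x-1)^2
    = (y-x+1) (y+x-1), and y + x - 1 < 2 (R+1). The square does not cut the row off: s' - i^2 is at
    most (3/4) s', below M^2. *)
Lemma row_growth M R i s s' : 0 < M -> s <= s' -> s' <= 4 * (i * i) ->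
  2 * (i * i) <= s' -> 10 * s' <= 13 * (M * M) -> s' < R.+1 * R.+1 ->
  (s' - s) + R.+1.*2 * row_count M i s <= R.+1.*2 * (row_count M i s').+1.
Proof.
move=> M0 ss s4 s2 s13 sR.
have dec t j : i * i + j.+1 * j.+1 <= t -> i * i + j * j <= t by nia.
have xy := row_count_mono M i ss.
have cle t : row_count M i t <= M by rewrite -{2}(size_iota 0 M) count_size.
have Hin t j : j < row_count M i t -> i * i + j * j <= t.
  move=> jl; have jM : j < M by exact: leq_trans (cle t).
  by rewrite -(count_initial (p := fun j => i * i + j * j <= t) _ jM) //; exact: dec.
have Hy : s' < i * i + row_count M i s' * row_count M i s'.
  have [yM|My] := ltnP (row_count M i s') M; last first.
    have -> : row_count M i s' = M by apply/eqP; rewrite eqn_leq cle.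
    nia.
  rewrite ltnNge -(count_initial (p := fun j => i * i + j * j <= s') _ yM) ?ltnn //.
  exact: dec.
set x := row_count M i s in xy *; set y := row_count M i s' in xy Hy *.
have yR : y <= R.+1.
  rewrite leqNgt; apply/negP => Ry.
  by have := Hin s' R.+1 Ry; nia.
have Hx : x = 0 \/ i * i + x.-1 * x.-1 <= s.
  case: (posnP x) => [->|x0]; [by left|right].
  by apply: Hin; rewrite -/x; lia.
rewrite -muln2.
case: Hx => [x0|Hx]; first by rewrite x0; nia.
case: (posnP x) => [x0|x0]; first by rewrite x0; nia.
have [x' xE] : exists x', x = x'.+1 by exists x.-1; lia.
rewrite xE /= in Hx xy *.
have [e yE] : exists e, y = x' + e.+1 by exists (y - x'.+1); lia.
have : s' - s < y * y - x' * x' by lia.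
rewrite yE in yR *; nia.
Qed.

(* Rows [i] with [s'/4 <= i^2 <= s'/2] meet the annulus inside the square and
   make up a fixed proportion of its diameter. *)
Lemma disc_count_growth M s s' : 4 < M -> s <= s' -> 10 * s' <= 13 * (M * M) ->
  (s' - s) + 20 * disc_count M s <= 20 * disc_count M s' + 20 * M.
Proof.
move=> M4 ss s13.
have [R Rs sR] : exists2 R, R * R <= s' & s' < R.+1 * R.+1.
  elim: (s') => [|t [R R1 R2]]; first by exists 0.
  by have [le|lt] := leqP (R.+1 * R.+1) t.+1; [exists R.+1 => //; nia | exists R => //; lia].
(* For R < 10 the slack 20 M, at least 100, already exceeds s'. *)
have [R10|R10] := ltnP R 10.
  have := disc_count_mono M ss; nia.
pose c i := (s' <= 4 * (i * i)) && (2 * (i * i) <= s').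
(* The integers above R / 2 and up to 7 R / 10 qualify, as (7/10)^2 < 1/2. *)
have Hc : R.+1 <= 10 * count c (iota 0 M).
  suff H : 7 * R %/ 10 - R %/ 2 <= count c (iota 0 M) by lia.
  rewrite -size_filter -[leqLHS](size_iota (R %/ 2).+1).
  apply: uniq_leq_size; first exact: iota_uniq.
  move=> i; rewrite mem_iota mem_filter mem_iota /c => Hi.
  have h1 : R.+1 <= 2 * i by lia.
  have h2 : 10 * i <= 7 * R by lia.
  rewrite -andbA; apply/and3P; split; nia.
have : \sum_(0 <= i < M) (c i * (s' - s) + R.+1.*2 * row_count M i s) <=
       \sum_(0 <= i < M) (R.+1.*2 * (row_count M i s').+1).
  apply: leq_sum => i _; case: (boolP (c i)) => ci.
    by rewrite mul1n; case/andP: ci => c1 c2; apply: row_growth => //; lia.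
  by rewrite mul0n add0n leq_mul2l; rewrite leqW ?orbT // row_count_mono.
rewrite big_split /= -big_distrl /= -!big_distrr /= -disc_count_rows.
have -> : \sum_(0 <= i < M) nat_of_bool (c i) = count c (iota 0 M).
  by rewrite -sum1_count [RHS]big_mkcond /= /index_iota subn0; apply: eq_bigr => i _; case: (c i).
have -> : \sum_(0 <= i < M) (row_count M i s').+1 = disc_count M s' + M.
  rewrite disc_count_rows (eq_bigr (fun i => row_count M i s' + 1)); last by move=> i _; rewrite addn1.
  by rewrite big_split /= sum_nat_const_nat subn0 muln1.
rewrite -muln2; move: (count c _) Hc (disc_count M s) (disc_count M s') => k Hk A B.
move: (s' - s) => D H.
(* At least (R+1) / 10 rows gain, each at the rate 1 / (2 (R+1)): this is the origin of the factor
   20. *)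
suff : R.+1 * (D + 20 * A) <= R.+1 * (20 * B + 20 * M) by rewrite leq_pmul2l.
nia.
Qed.

(** The disc contains the square of the cells with both indices below [B]. *)
Lemma disc_count_lower M B : B <= M -> B * B <= disc_count M (2 * (B * B)).
Proof.
move=> BM; rewrite disc_count_rows (big_cat_nat (n := B)) //=.
apply: leq_trans (leq_addr _ _).
rewrite -[leqLHS]/(B * B) -[X in X * _ <= _](subn0 B) -sum_nat_const_nat.
rewrite big_nat_cond [leqRHS]big_nat_cond; apply: leq_sum => i /andP[/andP[_ iB] _].
rewrite /row_count -(subnKC BM) iotaD count_cat; apply: leq_trans (leq_addr _ _).
rewrite (eq_in_count (a2 := predT)) ?count_predT ?size_iota // => j.
by rewrite mem_iota /= => jB; nia.
Qed.

(** * Ranks and squared distances *)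

Section Rank.
Variables (R : realType) (X : nat -> R * R) (n : nat).

Lemma tau_sorted u i j : i <= j < size (tau X n u) ->
  (dist2 (X u) (X (nth n (tau X n u) i)) <= dist2 (X u) (X (nth n (tau X n u) j)))%R.
Proof.
rewrite /tau; case: ifP => [un|_]; last by rewrite ltn0 andbF.
set le := fun a b => _; set s := sort _ _ => /andP[ij js].
have letot : total le by move=> a b; exact: le_total.
have letr : transitive le by move=> a b c; exact: le_trans.
apply: (sorted_leq_nth letr _ n (sort_sorted letot _)) => //; rewrite ?inE //.
- by move=> a; exact: lexx.
- exact: leq_ltn_trans js.
Qed.

Lemma rank_lower u v (p : pred nat) : u < n -> v < n ->
  (forall w, w < n -> p w -> (dist2 (X u) (X w) < dist2 (X u) (X v))%R) ->
  count p (iota 0 n) <= index v (tau X n u).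
Proof.
move=> un vn H; have /seq.permP <- := tau_perm X un.
have vt : v \in tau X n u by rewrite mem_tau.
set s := tau X n u in vt *; set k := index v s.
rewrite -(cat_take_drop k s) count_cat (_ : count p (drop k s) = 0).
  by rewrite addn0 (leq_trans (count_size _ _)) // size_take; case: ifP => // /negbT; lia.
apply/eqP; rewrite -leqn0 leqNgt -has_count; apply/hasPn => w /(nthP n)[i].
rewrite size_drop nth_drop => il <-; apply/negP => pw.
have kis : k + i < size s by rewrite -ltn_subRL.
have := H _ _ pw; rewrite -(mem_tau X _ un) mem_nth // => /(_ isT).
have vE : nth n s k = v by exact: nth_index.
have := @tau_sorted u k (k + i); rewrite -/s vE leq_addr kis ltNge => /(_ isT) -> //.
Qed.

Lemma rank_upper u v (p : pred nat) : u < n -> v < n ->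
  (forall w, w < n -> (dist2 (X u) (X w) <= dist2 (X u) (X v))%R -> p w) ->
  index v (tau X n u) < count p (iota 0 n).
Proof.
move=> un vn H; have /seq.permP <- := tau_perm X un.
have vt : v \in tau X n u by rewrite mem_tau.
set s := tau X n u in vt *; set k := index v s.
have ks : k < size s by rewrite index_mem.
rewrite -(cat_take_drop k.+1 s) count_cat; apply: leq_trans (leq_addr _ _).
have st : size (take k.+1 s) = k.+1 by apply: size_takel.
rewrite -{1}st (eq_in_count (a2 := predT)) ?count_predT // => w wt.
have wn : w < n by rewrite -(mem_tau X _ un) (mem_take wt).
apply: H => //; case/(nthP n): wt => i; rewrite st => ik.
rewrite nth_take // => <-; have vE : nth n s k = v by exact: nth_index.
by have := @tau_sorted u i k; rewrite -/s vE ks -ltnS ik; apply.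
Qed.

End Rank.

(** The Galois connection between the table and [disc_count]. *)
Lemma table_gt M k s : s < M * M + M * M -> (s < disc_table M k) = (disc_count M s <= k).
Proof.
move=> sm; rewrite /disc_table (count_initial (p := fun s => disc_count M s <= k)) //.
by move=> i; apply: leq_trans; exact: disc_count_mono.
Qed.

Section Accuracy.
(** [K v] stands for the key of [v] at a corner, [k] for the key of one vertex and [r] for its rank
    seen from a base vertex near that corner. The loss [e] comes from rounding to cells and from the
    position of the base vertex, [t] from the random counts. *)
Variables (M n t e r : nat) (K : nat -> nat) (k : nat).
Let m := M * M.
Let N s := count (fun v => K v <= s) (iota 0 n).
Hypothesis M4 : 4 < M.
Hypothesis HN : forall s, s < m + m -> N s <= disc_count M s + t /\ disc_count M s <= N s + t.
Hypothesis r_upper : r < N (k + e).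
Hypothesis r_lower : forall s, s + e < k -> N s <= r.
Let E := e + 20 * t + 20 * M + 1.
Hypothesis E_small : 100 * E <= m.

(** Raising the level by 20 t + 20 M + 1 gains more than [t] cells, which outweighs the deviation of
    the count. *)
Lemma table_upper : 100 * k <= 128 * m -> disc_table M r <= k + E.
Proof.
move=> km; rewrite leqNgt table_gt -/m; last by lia.
have k2m : k + e < m + m by lia.
have [H1 _] := HN k2m.
rewrite -ltnNge; have : (k + E - (k + e)) + 20 * disc_count M (k + e) <= 20 * disc_count M (k + E) + 20 * M.
  by apply: disc_count_growth => //; rewrite -/m; lia.
lia.
Qed.

Lemma table_lower s : s + E <= k -> 10 * (s + 20 * t + 20 * M) <= 13 * m ->
  s < disc_table M r.
Proof.
move=> sk sm; rewrite table_gt -/m; last by lia.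
have s2m : s + 20 * t + 20 * M < m + m by lia.
have [_ H1] := HN s2m.
have H2 : N (s + 20 * t + 20 * M) <= r by apply: r_lower; lia.
have : (s + 20 * t + 20 * M - s) + 20 * disc_count M s <=
       20 * disc_count M (s + 20 * t + 20 * M) + 20 * M.
  by apply: disc_count_growth => //; rewrite -/m; lia.
lia.
Qed.

(** If [k] were larger, [table_lower] applied to the table value itself would make that value
    smaller than itself. *)
Lemma table_near : near M (disc_table M r) -> 100 * k <= 128 * m.
Proof.
rewrite /near -/m leqNgt => H; rewrite leqNgt; apply/negP => km.
have := @table_lower (disc_table M r); rewrite ltnn => H'.
suff : false by []; apply: H'; lia.
Qed.

Lemma table_accurate : 100 * k <= 128 * m ->
  disc_table M r <= k + E /\ k <= disc_table M r + E.
Proof.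
move=> km; split; first exact: table_upper.
have [kE|Ek] := ltnP k E; first by lia.
by have := @table_lower (k - E); lia.
Qed.

End Accuracy.

(** * Geometry of the square *)

Lemma sqr_double_le i B : i * i <= 2 * (B * B) -> i <= 2 * B.
Proof. nia. Qed.

(** The cell is within 0.04 M of a corner in both coordinates, so its keys at the two adjacent
    corners lie between 0.96^2 M^2 and (1 + 0.04^2) M^2. *)
Lemma opposite_block_key M B i j : i < M -> j < M -> 100 * (2 * B + 1) <= 3 * M ->
  let i' := M.-1 - i in let j' := M.-1 - j in
  i * i + j' * j' <= 2 * (B * B) ->
  92 * (M * M) <= 100 * (i * i + j * j) <= 128 * (M * M) /\
  92 * (M * M) <= 100 * (i' * i' + j' * j') <= 128 * (M * M).
Proof.
move=> iM jM BM i' j' H.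
have iB : i <= 2 * B by apply: sqr_double_le; lia.
have jB : j' <= 2 * B by apply: sqr_double_le; lia.
have [i'E jE] : i' + i + 1 = M /\ j + j' + 1 = M by rewrite /i' /j'; split; lia.
clearbody i' j'; clear H.
have [i96 j96] : 96 * M <= 100 * i' /\ 96 * M <= 100 * j by split; lia.
have [i4 j4] : 100 * i <= 4 * M /\ 100 * j' <= 4 * M by split; lia.
have [i1 j1] : i' <= M /\ j <= M by split; lia.
have sq_lo k : 96 * M <= 100 * k -> 96 * 96 * (M * M) <= 100 * 100 * (k * k).
  by move=> H; have := leq_mul H H; lia.
have sq_hi k : 100 * k <= 4 * M -> 100 * 100 * (k * k) <= 16 * (M * M).
  by move=> H; have := leq_mul H H; lia.
have := sq_lo _ i96; have := sq_lo _ j96; have := sq_hi _ i4; have := sq_hi _ j4.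
have := leq_mul i1 i1; have := leq_mul j1 j1.
by move=> *; split; apply/andP; split; lia.
Qed.

Lemma estimate_far m K s E : 9 * m <= 10 * s -> (100 * K <= 128 * m -> s <= K + E) ->
  100 * E <= m -> 89 * m <= 100 * K.
Proof. by move=> H1 H2 H3; rewrite leqNgt; apply/negP => lt; have := H2 _; lia. Qed.

Lemma difference_bounds p q a b c E : b * b + c <= q + E -> q <= b * b + c + E ->
  a * a + c <= p + E -> p <= a * a + c + E ->
  p + b * b <= q + a * a + 2 * E /\ q + a * a <= p + b * b + 2 * E.
Proof. by move=> *; split; lia. Qed.

(** One coordinate contributes at most M^2, so a key above 1.25 M^2 forces j > M / 2. Then j' is at
    most M / 2, and both keys at the opposite side are at most 1.25 M^2. *)
Lemma mirror_key M i j : i < M -> j < M ->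
  let i' := M.-1 - i in let j' := M.-1 - j in
  125 * (M * M) < 100 * (i * i + j * j) \/ 125 * (M * M) < 100 * (i' * i' + j * j) ->
  100 * (i * i + j' * j') <= 128 * (M * M) /\ 100 * (i' * i' + j' * j') <= 128 * (M * M).
Proof.
move=> iM jM i' j' H.
have [i1 i'1] : i <= M /\ i' <= M by rewrite /i'; split; lia.
have := leq_mul i1 i1; have := leq_mul i'1 i'1 => h1 h2.
have j2 : M < 2 * j.
  rewrite ltnNge; apply/negP => h; have := leq_mul h h; lia.
have h : 2 * j' <= M by rewrite /j'; lia.
by have := leq_mul h h => ?; split; lia.
Qed.

Local Open Scope ring_scope.

Lemma sqr_le_cases (R : realDomainType) (a x : R) : 0 <= a -> a ^+ 2 <= x ^+ 2 ->
  a <= x \/ x <= - a.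
Proof. by move=> a0 ax; have [x0|x0] := lerP 0 x; [left|right]; nra. Qed.

Lemma ler_nat_square_sum (R : numDomainType) p a q b E : (p + a * a <= q + b * b + 2 * E)%N ->
  p%:R + a%:R * a%:R <= q%:R + b%:R * b%:R + 2 * E%:R :> R.
Proof. by move=> H; rewrite -!natrM -!natrD ler_nat. Qed.

Section Geometry.
Variables (R : realType) (X : nat -> R * R) (n M : nat) (cx cy : nat -> nat).
Let S : R := Num.sqrt n%:R.
Let h : R := S / 2.
Let w : R := S / M%:R.

(** Booleans name the two sides orthogonal to an axis: [h - sg b * x] is the distance of [x] to side
    [b], and [cidx b] counts cells from that side. Pairs of booleans name the corners. *)
Definition sg (b : bool) : R := if b then 1 else - 1.
Definition cidx (b : bool) (i : nat) : nat := if b then (M.-1 - i)%N else i.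
Definition corner_key (k : bool * bool) (v : nat) : nat :=
  (cidx k.1 (cx v) * cidx k.1 (cx v) + cidx k.2 (cy v) * cidx k.2 (cy v))%N.
Definition near_corner (k : bool * bool) (d : R) (p : R * R) :=
  h - sg k.1 * p.1 <= d /\ h - sg k.2 * p.2 <= d.
Definition opp (k : bool * bool) := (~~ k.1, ~~ k.2).

Hypotheses (M4 : (4 < M)%N) (Mn : (M * M <= n)%N) (nM : (n < M.+1 * M.+1)%N).
Hypothesis cells : forall v, (v < n)%N ->
  [/\ (cx v < M)%N, (cy v < M)%N,
      - h + (cx v)%:R * w <= (X v).1 < - h + (cx v).+1%:R * w &
      - h + (cy v)%:R * w <= (X v).2 < - h + (cy v).+1%:R * w].

Lemma side_facts : [/\ 0 < M%:R :> R, 1 <= w, M%:R * (w - 1) <= 1, S = M%:R * w & h = M%:R * w / 2].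
Proof.
have M0 : 0 < M%:R :> R by rewrite ltr0n; lia.
have SM : M%:R <= S.
  have -> : M%:R = Num.sqrt (M%:R ^+ 2) :> R by rewrite sqrtr_sqr ger0_norm // ltW.
  by apply: ler_wsqrtr; rewrite -natrX ler_nat -mulnn.
have SM1 : S <= M%:R + 1.
  have -> : M%:R + 1 = Num.sqrt (M.+1%:R ^+ 2) :> R by rewrite sqrtr_sqr ger0_norm // -natr1.
  by apply: ler_wsqrtr; rewrite -natrX ler_nat -mulnn ltnW.
have SE : S = M%:R * w by rewrite /w mulrC divfK // gt_eqF.
split=> //.
- by rewrite /w ler_pdivlMr // mul1r.
- by rewrite mulrBr mulr1 -SE; lra.
- by rewrite /h SE.
Qed.

Lemma cell_side b x i : (i < M)%N -> - h + i%:R * w <= x < - h + i.+1%:R * w ->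
  (cidx b i)%:R * w <= h - sg b * x <= ((cidx b i)%:R + 1) * w.
Proof.
have [M0 w1 _ SE hE] := side_facts.
move=> iM; rewrite -natr1 => /andP[x1 x2]; case: b; rewrite /sg /cidx; last first.
  by apply/andP; split; lra.
have -> : (M.-1 - i)%:R = M%:R - 1 - i%:R :> R.
  by rewrite -subn1 natrB ?natrB //; lia.
by apply/andP; split; nra.
Qed.

Lemma cidx_lt b i : (i < M)%N -> (cidx b i < M)%N.
Proof. by rewrite /cidx; case: b => //; lia. Qed.

Lemma sgN b : sg (~~ b) = - sg b.
Proof. by case: b; rewrite /sg /= ?opprK. Qed.

Lemma cells_side v b : (v < n)%N ->
  (0 <= h - sg b * (X v).1 <= h + h) /\ (0 <= h - sg b * (X v).2 <= h + h).
Proof.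
have [M0 w1 _ SE hE] := side_facts.
move=> /cells[xM yM Hx Hy].
have aux i : (i < M)%N -> 0 <= i%:R * w /\ (i%:R + 1) * w <= h + h.
  move=> iM; have : i%:R + 1 <= M%:R :> R by rewrite natr1 ler_nat.
  have : 0 <= i%:R :> R by [].
  by split; nra.
have [A1 A2] := aux _ (cidx_lt b xM); have [B1 B2] := aux _ (cidx_lt b yM).
by have := cell_side b xM Hx; have := cell_side b yM Hy; split; lra.
Qed.

Definition sqd (p q : R * R) : R := (p.1 - q.1) ^+ 2 + (p.2 - q.2) ^+ 2.

Lemma sqd_ge0 p q : 0 <= sqd p q.
Proof. by rewrite addr_ge0 ?sqr_ge0. Qed.

Lemma dist2_le p q p' q' : (dist2 p q <= dist2 p' q') = (sqd p q <= sqd p' q').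
Proof. by rewrite /dist2 ler_sqrt ?sqd_ge0. Qed.

Lemma sqd_corner k p q : sqd p q =
  ((h - sg k.1 * p.1) - (h - sg k.1 * q.1)) ^+ 2 + ((h - sg k.2 * p.2) - (h - sg k.2 * q.2)) ^+ 2.
Proof.
have H b : sg b * sg b = 1 by case: b; rewrite /sg ?mulr1 ?mulrNN ?mulr1.
transitivity ((sg k.1 * sg k.1) * (p.1 - q.1) ^+ 2 + (sg k.2 * sg k.2) * (p.2 - q.2) ^+ 2).
  by rewrite !H !mul1r.
by ring.
Qed.

(** The difference of squares factors; one factor is at most w + d, the other at most 2 S. *)
Lemma side_square d i yu yv : (i < M)%N -> 0 <= yu <= d -> d <= S ->
  i%:R * w <= yv <= (i%:R + 1) * w ->
  `|(yu - yv) ^+ 2 - w ^+ 2 * (i * i)%N%:R| <= 2 * S * (w + d).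
Proof.
have [M0 w1 _ SE hE] := side_facts.
move=> iM yud dS yvi; rewrite natrM.
have i1 : i%:R + 1 <= M%:R :> R by rewrite natr1 ler_nat.
have i0 : 0 <= i%:R :> R by [].
have -> : (yu - yv) ^+ 2 - w ^+ 2 * (i%:R * i%:R) =
  (yv - yu - i%:R * w) * (yv - yu + i%:R * w) by ring.
have iw : (i%:R + 1) * w <= S by rewrite SE ler_wpM2r //; lra.
have iw0 : 0 <= i%:R * w by rewrite mulr_ge0 //; lra.
rewrite normrM [leRHS]mulrC; apply: ler_pM => //; rewrite ler_norml; apply/andP; split; lra.
Qed.

Lemma near_sqd k d u v : (u < n)%N -> (v < n)%N -> near_corner k d (X u) -> d <= S ->
  `|sqd (X u) (X v) - w ^+ 2 * (corner_key k v)%:R| <= 4 * S * (w + d).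
Proof.
move=> un vn [n1 n2] dS.
have [xM yM Hx Hy] := cells vn.
have [/andP[a1 _] _] := cells_side k.1 un.
have [_ /andP[b1 _]] := cells_side k.2 un.
have A := @side_square d _ (h - sg k.1 * (X u).1) _ (cidx_lt k.1 xM) _ dS (cell_side k.1 xM Hx).
have B := @side_square d _ (h - sg k.2 * (X u).2) _ (cidx_lt k.2 yM) _ dS (cell_side k.2 yM Hy).
have {}A := A (introT andP (conj a1 n1)); have {}B := B (introT andP (conj b1 n2)).
rewrite (sqd_corner k) /corner_key natrD mulrDr.
move: A B; set p := (_ - _) ^+ 2; set q := (_ - _) ^+ 2.
by rewrite !ler_norml => /andP[? ?] /andP[? ?]; apply/andP; split; lra.
Qed.

(** Comparing two distances doubles the error of [near_sqd]; passing from squared distances to keys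
    divides by w^2, which is at least 1. *)
Lemma key_mono k d e u v v' : (u < n)%N -> (v < n)%N -> (v' < n)%N ->
  near_corner k d (X u) -> d <= S -> 8 * S * (w + d) <= e%:R ->
  dist2 (X u) (X v) <= dist2 (X u) (X v') -> (corner_key k v <= corner_key k v' + e)%N.
Proof.
have [M0 w1 _ SE hE] := side_facts.
move=> un vn vn' nk dS He; rewrite dist2_le => dd.
have := near_sqd un vn nk dS; have := near_sqd un vn' nk dS.
rewrite !ler_norml => /andP[_ A2] /andP[B1 _].
rewrite leqNgt; apply/negP => lt.
have {}lt : (corner_key k v')%:R + e%:R + 1 <= (corner_key k v)%:R :> R.
  by rewrite -natrD natr1 ler_nat.
have e0 : 0 <= e%:R :> R by [].
have : w ^+ 2 * ((corner_key k v')%:R + e%:R + 1) <= w ^+ 2 * (corner_key k v)%:R.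
  by rewrite ler_wpM2l // sqr_ge0.
have : 1 <= w ^+ 2 by rewrite expr_ge1 //; lra.
nra.
Qed.

(** * Locating the corners and recovering the coordinates *)

Section Estimates.
Variables (t B e : nat).
Let m := (M * M)%N.
Let E := (e + 20 * t + 20 * M + 1)%N.
(** Some vertex is within [d0] of both sides at each corner, and farthest vertices will be shown to
    lie within [d] of both sides at some corner. *)
Let d0 : R := (2 * B + 1)%N%:R * w.
Let d : R := 8 * d0.
Hypothesis counts : forall k s, (s < m + m)%N ->
  (count (fun v => corner_key k v <= s)%N (iota 0 n) <= disc_count M s + t)%N /\
  (disc_count M s <= count (fun v => corner_key k v <= s)%N (iota 0 n) + t)%N.
Hypothesis occupied : forall k, exists2 q, (q < n)%N & (corner_key k q <= 2 * (B * B))%N.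
Hypothesis Be : (100 * (2 * B + 1) <= 3 * M)%N.
Hypothesis He : 8 * S * (w + d) <= e%:R.
Hypothesis HE : (100 * E <= m)%N.

Lemma d_small : [/\ 0 < d0, d <= h * (48 / 100), d <= S & 0 < h].
Proof.
have [M0 w1 _ SE hE] := side_facts.
have w0 : 0 < w by lra.
have d00 : 0 < d0 by rewrite mulr_gt0 // ltr0n; lia.
have h0 : 0 < h by rewrite hE divr_gt0 // mulr_gt0.
have dh : d <= h * (48 / 100).
  have : (100 * (2 * B + 1))%N%:R <= (3 * M)%N%:R :> R by rewrite ler_nat.
  by rewrite !natrM /d /d0 hE => ?; nra.
by split=> //; rewrite /h in h0 dh; lra.
Qed.

Lemma estimate_accurate k u v : (u < n)%N -> (v < n)%N -> near_corner k d (X u) ->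
  let s := estimate X n M u v in
  [/\ (100 * corner_key k v <= 128 * m)%N -> (s <= corner_key k v + E)%N,
      (100 * corner_key k v <= 128 * m)%N -> (corner_key k v <= s + E)%N &
      near M s -> (100 * corner_key k v <= 128 * m)%N].
Proof.
move=> un vn nk s.
have [_ _ dS _] := d_small.
have ru : (index v (tau X n u) < count (fun v' => corner_key k v' <= corner_key k v + e)%N (iota 0 n))%N.
  by apply: rank_upper => // v' vn' dd; exact: (key_mono un vn' vn nk dS He dd).
have rl s' : (s' + e < corner_key k v)%N ->
    (count (fun v' => corner_key k v' <= s')%N (iota 0 n) <= index v (tau X n u))%N.
  move=> sk; apply: rank_lower => // v' vn' kv'; rewrite ltNge; apply/negP => dd.
  have := key_mono un vn vn' nk dS He dd; lia.
have acc := table_accurate M4 (counts k) ru rl HE.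
have nr := table_near M4 (counts k) ru rl HE.
by split=> // km; have [] := acc km.
Qed.

Lemma occupied_near k : exists q, [/\ (q < n)%N, near_corner k d0 (X q) &
  (corner_key k q <= 2 * (B * B))%N].
Proof.
have [M0 w1 _ SE hE] := side_facts.
have [q qn kq] := occupied k; exists q; split=> //.
have [xM yM Hx Hy] := cells qn.
have aux i : (i * i <= 2 * (B * B))%N -> (i%:R + 1) * w <= d0.
  move=> /sqr_double_le.
  move=> i2; rewrite /d0 addn1 natr1; apply: ler_wpM2r; first by lra.
  by rewrite ler_nat ltnS.
rewrite /corner_key in kq.
have /andP[_ A] := cell_side k.1 xM Hx; have /andP[_ C] := cell_side k.2 yM Hy.
split; [apply: le_trans A _ | apply: le_trans C _]; apply: aux.
  exact: leq_trans (leq_addr _ _) kq.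
exact: leq_trans (leq_addl _ _) kq.
Qed.

Lemma farthest_lt u : (u < n)%N -> (farthest X n u < n)%N.
Proof.
move=> un; rewrite -(mem_tau X _ un) /farthest.
have := size_tau X un; case: (tau X n u) => [|x s _ /=]; first by move=> /= ?; lia.
exact: mem_last.
Qed.

Lemma farthest_max u q : (u < n)%N -> (q < n)%N ->
  dist2 (X u) (X q) <= dist2 (X u) (X (farthest X n u)).
Proof.
move=> un qn; have qt : q \in tau X n u by rewrite mem_tau.
have fE : farthest X n u = nth n (tau X n u) (size (tau X n u)).-1.
  rewrite /farthest; case: (tau X n u) qt => // x s _.
  by rewrite nth_last.
rewrite fE -{1}(nth_index n qt); apply: tau_sorted.
have : (index q (tau X n u) < size (tau X n u))%N by rewrite index_mem.
by lia.
Qed.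

(* [y = h - sg b * x] is the distance of a point to the side [b]; [D] and [D']
   are the distances of the base vertex to the two sides farthest from it. *)
Lemma farthest_side D D' y y' yq yq' : h <= D <= h + h -> h <= D' <= h + h ->
  0 <= y <= h + h -> 0 <= y' <= h + h -> 0 <= yq <= d0 -> 0 <= yq' <= d0 ->
  (D - yq) ^+ 2 + (D' - yq') ^+ 2 <= (D - y) ^+ 2 + (D' - y') ^+ 2 ->
  (y <= d \/ h + h - y <= d) /\ (h + h / 2 <= D -> y <= d).
Proof.
have [d00 dh dS h0] := d_small.
move=> hD hD' hy hy' hq hq' H.
(* Comparison with the occupied vertex loses at most 2 (D + D') d0, and D + D' is at most 4 h: this
   is the 8 in [d]. *)
have {}H : y * (2 * D - y) <= h * d.
  have e1 : (D - d0) ^+ 2 <= (D - yq) ^+ 2 by rewrite ler_sqr ?nnegrE; rewrite /d in dh; lra.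
  have e2 : (D' - d0) ^+ 2 <= (D' - yq') ^+ 2 by rewrite ler_sqr ?nnegrE; rewrite /d in dh; lra.
  have e3 : (D' - y') ^+ 2 <= D' ^+ 2 by nra.
  have e4 : (D + D') * d0 <= 4 * h * d0 by rewrite ler_wpM2r //; lra.
  rewrite /d; nra.
(* One of the factors y and 2 D - y is at least h, so the other is at most d. *)
have [yh|hy1] := lerP y h.
  have : y * h <= d * h by apply: le_trans (_ : y * (2 * D - y) <= _); [nra | lra].
  by rewrite ler_pM2r // => yd; split; [left|].
have : h * (2 * D - y) <= h * d by nra.
rewrite ler_pM2l // => Dd.
by split; [right; lra | lra].
Qed.

Lemma exists_sg (x : R) : exists b, sg b * x <= 0.
Proof.
by have [x0|x0] := lerP x 0; [exists true | exists false]; rewrite /sg; lra.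
Qed.

(** [k] is a corner farthest from [u]. Along an axis where [u] is near the middle, the farthest
    vertex may lie at either side, whence the disjunctions; distance at least 3 h / 2 to a side
    decides. *)
Lemma farthest_sides u k : (u < n)%N -> sg k.1 * (X u).1 <= 0 -> sg k.2 * (X u).2 <= 0 ->
  let y1 := h - sg k.1 * (X (farthest X n u)).1 in
  let y2 := h - sg k.2 * (X (farthest X n u)).2 in
  [/\ y1 <= d \/ h + h - y1 <= d, y2 <= d \/ h + h - y2 <= d,
      h + h / 2 <= h - sg k.1 * (X u).1 -> y1 <= d &
      h + h / 2 <= h - sg k.2 * (X u).2 -> y2 <= d].
Proof.
move=> un k1 k2 y1 y2.
have [q [qn [nq1 nq2] _]] := occupied_near k.
have := farthest_max un qn; rewrite dist2_le !(sqd_corner k).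
have fn := farthest_lt un.
have [/andP[u1 u1'] _] := cells_side k.1 un; have [_ /andP[u2 u2']] := cells_side k.2 un.
have [f1 _] := cells_side k.1 fn; have [_ f2] := cells_side k.2 fn.
have [/andP[q1 _] _] := cells_side k.1 qn; have [_ /andP[q2 _]] := cells_side k.2 qn.
rewrite -/y1 -/y2 in f1 f2 *.
set D := h - sg k.1 * (X u).1 in u1 u1' *; set D' := h - sg k.2 * (X u).2 in u2 u2' *.
have hD : h <= D <= h + h by rewrite u1' andbT /D; lra.
have hD' : h <= D' <= h + h by rewrite u2' andbT /D'; lra.
move=> H.
have [A1 A2] := farthest_side hD hD' f1 f2 (introT andP (conj q1 nq1)) (introT andP (conj q2 nq2)) H.
rewrite addrC [leRHS]addrC in H.
have [B1 B2] := farthest_side hD' hD f2 f1 (introT andP (conj q2 nq2)) (introT andP (conj q1 nq1)) H.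
by split.
Qed.

Lemma farthest_corner u : (u < n)%N -> exists k, near_corner k d (X (farthest X n u)).
Proof.
move=> un; have [b1 H1] := exists_sg (X u).1; have [b2 H2] := exists_sg (X u).2.
have [A1 A2 _ _] := @farthest_sides u (b1, b2) un H1 H2.
have aux b x : h - sg b * x <= d \/ h + h - (h - sg b * x) <= d ->
    exists b', h - sg b' * x <= d.
  by case=> ?; [exists b | exists (~~ b); rewrite sgN; lra].
have [c1 C1] := aux _ _ A1; have [c2 C2] := aux _ _ A2.
by exists (c1, c2).
Qed.

Lemma farthest_opposite u k : (u < n)%N -> near_corner k (h / 2) (X u) ->
  near_corner (opp k) d (X (farthest X n u)).
Proof.
have [d00 dh dS h0] := d_small.
move=> un [n1 n2].
have H1 : sg (opp k).1 * (X u).1 <= 0 by rewrite /= sgN; lra.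
have H2 : sg (opp k).2 * (X u).2 <= 0 by rewrite /= sgN; lra.
have [_ _ A1 A2] := farthest_sides un H1 H2.
by move: A1 A2; rewrite /near_corner /= !sgN => A1 A2; split; [apply: A1 | apply: A2]; lra.
Qed.

Lemma cidxN b i : (i < M)%N -> cidx (~~ b) i = (M.-1 - cidx b i)%N.
Proof. by rewrite /cidx; case: b => //=; lia. Qed.

(** The witness is the occupied vertex at a third corner. *)
Lemma far_exists k a b : (a < n)%N -> (b < n)%N ->
  near_corner k d (X a) -> near_corner (opp k) d (X b) ->
  exists2 v, (v < n)%N & far X n M a b v.
Proof.
move=> an bn na nb.
have [q [qn _]] := occupied_near (k.1, ~~ k.2).
have [xM yM _ _] := cells qn.
rewrite /corner_key /= cidxN // => kq; exists q => //.
have [_ A _] := estimate_accurate an qn na; have [_ C _] := estimate_accurate bn qn nb.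
move: A C; rewrite /far /corner_key /= !cidxN // -/m.
have := cidx_lt k.1 xM; have := cidx_lt k.2 yM.
move=> jM iM A C.
have [/andP[h1 h2] /andP[h3 h4]] := opposite_block_key iM jM Be kq.
by apply/andP; split; [have := A _ | have := C _]; rewrite -/m in h1 h2 h3 h4; lia.
Qed.

(** With xi and eta the signed coordinates of [z], the keys give (h - xi)^2 + (h - eta)^2 and (h +
    xi)^2 + (h + eta)^2 at least 4 * 0.89 h^2 = 3.56 h^2. Their sum yields xi^2 + eta^2 at least
    1.56 h^2, so both coordinates exceed h / 2 in absolute value. Equal signs would put [z] too
    close to [a] or [b]. *)
Lemma far_corner k a b z : (a < n)%N -> (b < n)%N -> (z < n)%N ->
  near_corner k d (X a) -> near_corner (opp k) d (X b) -> far X n M a b z ->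
  near_corner (~~ k.1, k.2) (h / 2) (X z) \/ near_corner (k.1, ~~ k.2) (h / 2) (X z).
Proof.
move=> an bn zn na nb /andP[fa fb].
have [M0 w1 _ SE hE] := side_facts; have [d00 dh dS h0] := d_small.
have [xM yM Hx Hy] := cells zn.
have key_ge k' u : (u < n)%N -> near_corner k' d (X u) ->
    (9 * m <= 10 * estimate X n M u z)%N ->
    356 / 100 * h ^+ 2 <= (h - sg k'.1 * (X z).1) ^+ 2 + (h - sg k'.2 * (X z).2) ^+ 2.
  move=> un nu fu; have [A _ _] := estimate_accurate un zn nu.
  have K89 : (89 * m <= 100 * corner_key k' z)%N.
    exact: estimate_far fu A HE.
  have {}K89 : 89 * (M%:R * M%:R) <= 100 * (corner_key k' z)%:R :> R.
    by move: K89; rewrite -(ler_nat R) !natrM.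
  have /andP[A1 _] := cell_side k'.1 xM Hx; have /andP[A2 _] := cell_side k'.2 yM Hy.
  move: K89; rewrite /corner_key natrD !natrM.
  move: (cidx k'.1 _) (cidx k'.2 _) A1 A2 => i j A1 A2 K89.
  have w0 : 0 <= w by lra.
  have s1 : (i%:R * w) ^+ 2 <= (h - sg k'.1 * (X z).1) ^+ 2.
    have iw : 0 <= i%:R * w by exact: mulr_ge0.
    by rewrite ler_sqr ?nnegrE // (le_trans iw).
  have s2 : (j%:R * w) ^+ 2 <= (h - sg k'.2 * (X z).2) ^+ 2.
    have iw : 0 <= j%:R * w by exact: mulr_ge0.
    by rewrite ler_sqr ?nnegrE // (le_trans iw).
  have : 89 * (M%:R * M%:R) * w ^+ 2 <= 100 * (i%:R * i%:R + j%:R * j%:R) * w ^+ 2.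
    by rewrite ler_wpM2r // sqr_ge0.
  have -> : h ^+ 2 = M%:R * M%:R * w ^+ 2 / 4 by rewrite hE; field.
  move: s1 s2; set p := (h - _) ^+ 2; set q := (h - _) ^+ 2; lra.
have := key_ge _ _ an na fa; have := key_ge _ _ bn nb fb.
have [/andP[x1 x2] _] := cells_side k.1 zn; have [_ /andP[y1 y2]] := cells_side k.2 zn.
rewrite /near_corner /= !sgN.
set xi := sg k.1 * (X z).1 in x1 x2 *; set eta := sg k.2 * (X z).2 in y1 y2 *.
rewrite !mulNr -/xi -/eta => H1 H2.
have xi2 : xi ^+ 2 <= h ^+ 2 by nra.
have eta2 : eta ^+ 2 <= h ^+ 2 by nra.
have xi5 : (h / 2) ^+ 2 <= xi ^+ 2 by nra.
have eta5 : (h / 2) ^+ 2 <= eta ^+ 2 by nra.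
have h20 : 0 <= h / 2 by lra.
case: (sqr_le_cases h20 xi5) => hx; case: (sqr_le_cases h20 eta5) => hy.
- by exfalso; nra.
- by right; lra.
- by left; lra.
- by exfalso; nra.
Qed.

Definition accurate (K s : nat) :=
  [/\ (100 * K <= 128 * m)%N -> (s <= K + E)%N,
      (100 * K <= 128 * m)%N -> (K <= s + E)%N &
      near M s -> (100 * K <= 128 * m)%N].

(** If both tests succeed, [p] and [q] are accurate; if one fails, [mirror_key] makes [p'] and [q']
    accurate. The error 2 E of a difference is divided by 2 M, and the 4 leaves room for rounding to
    cells. *)
Lemma coord_close i j (y : R) p q p' q' : (i < M)%N -> (j < M)%N ->
  i%:R * w <= y <= (i%:R + 1) * w ->
  let i' := (M.-1 - i)%N in let j' := (M.-1 - j)%N in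
  accurate (i * i + j * j) p -> accurate (i' * i' + j * j) q ->
  accurate (i * i + j' * j') p' -> accurate (i' * i' + j' * j') q' ->
  `|(y - h) - coord R M p q p' q'| <= 4 + E%:R / M%:R.
Proof.
have [M0 w1 wM SE hE] := side_facts.
move=> iM jM yi i' j' Ap Aq Ap' Aq'.
have [P [Q [-> [H1 H3]]]] : exists P Q, coord R M p q p' q' = (P%:R - Q%:R) / (M + M)%N%:R /\
    ((P + i' * i') <= (Q + i * i) + 2 * E)%N /\ ((Q + i * i) <= (P + i' * i') + 2 * E)%N.
  rewrite /coord; case: ifP => [/andP[np nq]|npq].
    exists p, q; split=> //; case: Ap => [P1 P2 P3]; case: Aq => [Q1 Q2 Q3].
    have := P1 (P3 np); have := P2 (P3 np); have := Q1 (Q3 nq); have := Q2 (Q3 nq).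
    exact: difference_bounds.
  exists p', q'; split=> //.
  have [K1 K2] : (100 * (i * i + j' * j') <= 128 * m /\ 100 * (i' * i' + j' * j') <= 128 * m)%N.
    have : (125 * m < 100 * (i * i + j * j) \/ 125 * m < 100 * (i' * i' + j * j))%N.
      apply/orP; apply: contraFT npq; rewrite negb_or -!leqNgt => /andP[h1 h2].
      case: Ap => [P1 _ _]; case: Aq => [Q1 _ _]; rewrite /near -/m.
      by apply/andP; split; [have := P1 _ | have := Q1 _]; lia.
    exact: mirror_key.
  case: Ap' => [P1 P2 _]; case: Aq' => [Q1 Q2 _].
  have := P1 K1; have := P2 K1; have := Q1 K2; have := Q2 K2.
  exact: difference_bounds.
have i'E : i'%:R = M%:R - 1 - i%:R :> R by rewrite /i' -subn1 natrB ?natrB //; lia.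
move: H1 H3 => /(@ler_nat_square_sum R) + /(@ler_nat_square_sum R).
rewrite i'E => H1 H3.
have i1 : i%:R + 1 <= M%:R :> R by rewrite natr1 ler_nat.
have i0 : 0 <= i%:R :> R by [].
(* The cell's position relative to the centre, in units of the side; the exact difference of keys is
   2 c M (M - 1). *)
pose c : R := (i%:R - (M%:R - 1) / 2) / M%:R.
have cM : c * M%:R = i%:R - (M%:R - 1) / 2 by rewrite /c divfK // gt_eqF.
have c2 : - (1 / 2) <= c <= 1 / 2.
  by rewrite /c ler_pdivlMr // ler_pdivrMr //; apply/andP; split; lra.
rewrite [(M + M)%:R]natrD; set f := (P%:R - Q%:R) / (M%:R + M%:R).
have fM : f * (M%:R + M%:R) = P%:R - Q%:R by rewrite /f divfK // gt_eqF // addr_gt0.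
set g := E%:R / M%:R.
have gM : g * M%:R = E%:R by rewrite /g divfK // gt_eqF.
have iE : i%:R = c * M%:R + (M%:R - 1) / 2 by lra.
have fc : `|f - c * (M%:R - 1)| <= g.
  have M2 : 0 < M%:R + M%:R :> R by rewrite addr_gt0.
  have fE : (f - c * (M%:R - 1)) * (M%:R + M%:R) = P%:R - Q%:R - 2 * (c * M%:R) * (M%:R - 1).
    by rewrite -fM; ring.
  have gE : g * (M%:R + M%:R) = 2 * E%:R by rewrite mulrDr gM; ring.
  rewrite ler_norml; apply/andP; split; rewrite -(ler_pM2r M2) ?mulNr fE gE cM; lra.
have cw : `|c * (M%:R * (w - 1))| <= 1 / 2.
  rewrite normrM -[leRHS]mulr1; apply: ler_pM => //; first by rewrite ler_norml.
  by rewrite ger0_norm // mulr_ge0 ?subr_ge0 // ltW.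
have w2 : w <= 2 by nra.
have yE : y - h = (y - i%:R * w) - w / 2 + c * M%:R + c * (M%:R * (w - 1)).
  by rewrite hE iE; field.
move: fc cw; rewrite !ler_norml => /andP[? ?] /andP[? ?]; rewrite yE.
by apply/andP; split; lra.
Qed.

Lemma accurateC a b s : accurate (a + b) s -> accurate (b + a) s.
Proof. by rewrite addnC. Qed.

(** The corner of [a] fixes the two signs of the symmetry. Which of the remaining corners [c]
    occupies decides whether [a] and [c] differ in the first or the second coordinate, that is,
    whether the axes are exchanged. *)
Lemma embedding_close z : far_vertex X n M z -> (0 < n)%N ->
  let est := estimate X n M in
  let a := farthest X n 0 in let b := farthest X n a in
  let c := farthest X n z in let d := farthest X n c in
  exists2 i, (i < 8)%N & forall v, (v < n)%N ->
    let p := nth (fun p => p) (sq_syms R) i (X v) in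
    `|p.1 - coord R M (est a v) (est c v) (est d v) (est b v)| <= 4 + E%:R / M%:R /\
    `|p.2 - coord R M (est a v) (est d v) (est c v) (est b v)| <= 4 + E%:R / M%:R.
Proof.
have [d00 dh dS h0] := d_small.
move=> [_ zn farz] n0 est a b c d1.
have an : (a < n)%N by exact: farthest_lt.
have bn : (b < n)%N by exact: farthest_lt.
have {}zn := zn n0.
have cn : (c < n)%N by exact: farthest_lt.
have dn : (d1 < n)%N by exact: farthest_lt.
have [k nka] := farthest_corner n0; rewrite -/a in nka.
have inside k' u : near_corner k' d (X u) -> near_corner k' (h / 2) (X u).
  by move=> [? ?]; split; lra.
have nkb : near_corner (opp k) d (X b) by apply: farthest_opposite => //; exact: inside.
have {}farz : far X n M a b z by apply: farz; exact: far_exists nka nkb.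
have final k' : near_corner (opp k') d (X c) -> near_corner k' d (X d1) ->
    (k' = (k.1, ~~ k.2) \/ k' = (~~ k.1, k.2)) ->
    forall v, (v < n)%N -> forall b1 x1 b2 x2,
    (if k'.1 == k.1 then [/\ b1 = k.1, x1 = (X v).1, b2 = k.2 & x2 = (X v).2]
     else [/\ b1 = k.2, x1 = (X v).2, b2 = k.1 & x2 = (X v).1]) ->
    `|- sg b1 * x1 - coord R M (est a v) (est c v) (est d1 v) (est b v)| <= 4 + E%:R / M%:R /\
    `|- sg b2 * x2 - coord R M (est a v) (est d1 v) (est c v) (est b v)| <= 4 + E%:R / M%:R.
  move=> nc nd kk v vn b1 x1 b2 x2.
  have Aa : accurate (corner_key k v) (est a v) := estimate_accurate an vn nka.
  have Ab : accurate (corner_key (opp k) v) (est b v) := estimate_accurate bn vn nkb.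
  have Ac : accurate (corner_key (opp k') v) (est c v) := estimate_accurate cn vn nc.
  have Ad : accurate (corner_key k' v) (est d1 v) := estimate_accurate dn vn nd.
  have [xM yM Hx Hy] := cells vn.
  have Sx := cell_side k.1 xM Hx; have Sy := cell_side k.2 yM Hy.
  have iM := cidx_lt k.1 xM; have jM := cidx_lt k.2 yM.
  have yh b3 x3 : - sg b3 * x3 = h - sg b3 * x3 - h by ring.
  move: (est a v) (est b v) (est c v) (est d1 v) Aa Ab Ac Ad => sa sb sc sd.
  rewrite /corner_key.
  case: kk => -> /=; rewrite ?eqxx ?negbK !cidxN //; last first.
    rewrite (negbTE (_ : ~~ k.1 != k.1)); last by case: (k.1).
    move=> Aa Ab Ac Ad [-> -> -> ->]; rewrite !yh; split.
      exact: (coord_close jM iM Sy (accurateC Aa) (accurateC Ac) (accurateC Ad) (accurateC Ab)).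
    exact: (coord_close iM jM Sx Aa Ad Ac Ab).
  move=> Aa Ab Ac Ad [-> -> -> ->]; rewrite !yh; split.
    exact: (coord_close iM jM Sx Aa Ac Ad Ab).
  exact: (coord_close jM iM Sy (accurateC Aa) (accurateC Ad) (accurateC Ac) (accurateC Ab)).
have corner_c k' : near_corner k' (h / 2) (X z) ->
    near_corner (opp k') d (X c) /\ near_corner k' d (X d1).
  move=> nz; have nc : near_corner (opp k') d (X c) by exact: farthest_opposite.
  split=> //; rewrite (_ : k' = opp (opp k')); last by case: (k') => x y; rewrite /opp /= !negbK.
  by apply: farthest_opposite => //; exact: inside.
have [nz|nz] := far_corner an bn zn nka nkb farz; have [nc nd] := corner_c _ nz.
- have F := final _ nc nd (or_intror erefl).
  exists (if k.1 then if k.2 then 7 else 6 else if k.2 then 5 else 4)%N.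
    by case: k.1; case: k.2.
  move=> v vn; have := F v vn k.2 (X v).2 k.1 (X v).1.
  rewrite /= (negbTE (_ : ~~ k.1 != k.1)); last by case: (k.1).
  move=> /(_ (And4 erefl erefl erefl erefl)).
  by case: k.1; case: k.2; rewrite /sg /= ?opprK ?mulN1r ?mul1r.
- have F := final _ nc nd (or_introl erefl).
  exists (if k.1 then if k.2 then 3 else 1 else if k.2 then 2 else 0)%N.
    by case: k.1; case: k.2.
  move=> v vn; have := F v vn k.1 (X v).1 k.2 (X v).2.
  rewrite /= eqxx => /(_ (And4 erefl erefl erefl erefl)).
  by case: k.1; case: k.2; rewrite /sg /= ?opprK ?mulN1r ?mul1r.
Qed.

End Estimates.
End Geometry.

(** * Concentration *)

(* Restores the names of [exp] that [Rstruct] shadows. *)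
Import exp.

Section Fraction.
Variables (R : realType) (T : finType).

(** The uniform probability on a finite type: tail bounds are proved by counting, and
    [discretization] transfers them to the measure. *)
Definition fraction (A : {set T}) : R := #|A|%:R / #|T|%:R.

Lemma fraction_sub (A B : {set T}) : A \subset B -> fraction A <= fraction B.
Proof. by move=> AB; rewrite ler_wpM2r ?invr_ge0 // ler_nat subset_leq_card. Qed.

Lemma fractionU (A B : {set T}) : fraction (A :|: B) <= fraction A + fraction B.
Proof. by rewrite -mulrDl ler_wpM2r ?invr_ge0 // -natrD ler_nat leq_card_setU. Qed.

Lemma fraction_bigcup (I : finType) (P : pred I) (A : I -> {set T}) :
  fraction (\bigcup_(i | P i) A i) <= \sum_(i | P i) fraction (A i).
Proof.
elim/big_rec2: _ => [|i x y _ IH]; first by rewrite /fraction cards0 mul0r.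
by apply: le_trans (fractionU _ _) _; rewrite lerD2l.
Qed.

End Fraction.

(** Inverting exp(-x) >= 1 - x gives exp(x) <= 1 / (1 - x). *)
Lemma expR_quad (R : realType) (x : R) : `|x| <= 1 / 2 -> expR x <= 1 + x + 2 * x ^+ 2.
Proof.
rewrite ler_norml => /andP[x1 x2].
have x0 : 0 < 1 - x by lra.
have : expR x <= (1 - x)^-1.
  by rewrite -[leLHS]invrK -expRN lef_pV2 ?posrE ?expR_gt0 // expR_ge1Dx.
move/le_trans; apply; rewrite -[leLHS]mul1r ler_pdivrMr //; nra.
Qed.

Section Chernoff.
Variables (R : realType) (n : nat) (C : finType).
Implicit Types (U V : {set C}) (f : {ffun 'I_n -> C}).
Let F := {ffun 'I_n -> C}.

Definition hits U f : nat := \sum_(v < n) (f v \in U).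
Definition density U : R := #|U|%:R / #|C|%:R.
Definition deviates U (t : R) : {set F} :=
  [set f | t <= `|(hits U f)%:R - n%:R * density U|].

Hypothesis C0 : (0 < #|C|)%N.

(** This is independence: expanding the power of a sum over cells produces one term for each
    assignment of cells to vertices. *)
Lemma hits_mgf U (x : R) : \sum_(f : F) expR (x * (hits U f)%:R) =
  (\sum_(c : C) expR (x * (c \in U)%:R)) ^+ n.
Proof.
have -> : (\sum_(c : C) expR (x * (c \in U)%:R)) ^+ n =
    \prod_(v < n) \sum_(c : C) expR (x * (c \in U)%:R).
  by rewrite prodr_const card_ord.
rewrite bigA_distr_bigA; apply: eq_bigr => f _.
by rewrite -expR_sum /hits natr_sum mulr_sumr.
Qed.

Lemma cell_mgf U (x : R) : \sum_(c : C) expR (x * (c \in U)%:R) <=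
  #|C|%:R * expR (density U * (expR x - 1)).
Proof.
have Cpos : 0 < #|C|%:R :> R by rewrite ltr0n.
have -> : \sum_(c : C) expR (x * (c \in U)%:R) = #|C|%:R + #|U|%:R * (expR x - 1).
  rewrite (eq_bigr (fun c => 1 + (c \in U)%:R * (expR x - 1))); last first.
    by move=> c _; case: (c \in U); [rewrite mulr1 mul1r addrC subrK | rewrite mulr0 mul0r exp.expR0 addr0].
  rewrite big_split /= -mulr_suml -natr_sum sumr_const; congr (_ + _%:R * _).
  by rewrite -sum1_card [RHS]big_mkcond /=; apply: eq_bigr => c _; case: (c \in U).
have -> : #|C|%:R + #|U|%:R * (expR x - 1) = #|C|%:R * (1 + density U * (expR x - 1)).
  by rewrite [RHS]mulrDr mulr1 mulrA /density (mulrC #|C|%:R) divfK // gt_eqF.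
by rewrite ler_pM2l // expR_ge1Dx.
Qed.

(** Markov's inequality for the exponential moment; the sign of [x] selects the tail. *)
Lemma chernoff_one_sided U (x a : R) : `|x| <= 1 / 2 ->
  fraction R [set f : F | a <= x * ((hits U f)%:R - n%:R * density U)] <=
  expR (2 * n%:R * density U * x ^+ 2 - a).
Proof.
move=> x2; set A := [set f : F | _].
have Cpos : 0 < #|C|%:R :> R by rewrite ltr0n.
have q0 : 0 <= density U by rewrite divr_ge0.
rewrite /fraction ler_pdivrMr ?card_ffun ?card_ord ?ltr0n ?expn_gt0 ?C0 //.
have H1 : #|A|%:R <= \sum_(f : F) expR (x * (hits U f)%:R) * expR (- (x * (n%:R * density U)) - a).
  rewrite -sum1_card natr_sum big_mkcond /=; apply: ler_sum => f _.
  rewrite inE; case: ifP => [fA|_]; last by rewrite mulr_ge0 ?expR_ge0.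
  by rewrite -expRD -[leLHS]exp.expR0 ler_expR; lra.
apply: le_trans H1 _; rewrite -mulr_suml hits_mgf.
have H2 : (\sum_(c : C) expR (x * (c \in U)%:R)) ^+ n <=
          (#|C|%:R * expR (density U * (expR x - 1))) ^+ n.
  apply: lerXn2r; rewrite ?nnegrE ?mulr_ge0 ?expR_ge0 ?cell_mgf //.
  by apply: sumr_ge0 => c _; rewrite expR_ge0.
apply: le_trans (ler_wpM2r (expR_ge0 _) H2) _.
rewrite exprMn -expRM_natl natrX -[leLHS]mulrA -expRD [leRHS]mulrC ler_pM2l ?exprn_gt0 //.
rewrite ler_expR.
have e2 := expR_quad x2.
have : n%:R * density U * (expR x - 1 - x) <= n%:R * density U * (2 * x ^+ 2).
  by rewrite ler_wpM2l ?mulr_ge0 //; lra.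
lra.
Qed.

Lemma chernoff U (x t : R) : 0 <= x <= 1 / 2 ->
  fraction R (deviates U t) <= 2 * expR (2 * n%:R * density U * x ^+ 2 - x * t).
Proof.
move=> /andP[x0 x2].
have xn : `|x| <= 1 / 2 by rewrite ger0_norm.
have xn' : `|- x| <= 1 / 2 by rewrite normrN.
have H1 := @chernoff_one_sided U x (x * t) xn.
have H2 := @chernoff_one_sided U (- x) (x * t) xn'.
apply: le_trans (fraction_sub (B := [set f : F | x * t <= x * ((hits U f)%:R - n%:R * density U)]
  :|: [set f : F | x * t <= - x * ((hits U f)%:R - n%:R * density U)]) _ _) _.
  apply/fintype.subsetP => f; rewrite !inE mulNr -mulrN => ft.
  have : t <= (hits U f)%:R - n%:R * density U \/ t <= - ((hits U f)%:R - n%:R * density U).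
    by move: ft; rewrite ler_normr => /orP[?|?]; [left|right].
  by case=> ht; apply/orP; [left|right]; rewrite ler_wpM2l.
apply: le_trans (fractionU _ _ _) _; rewrite sqrrN in H2; lra.
Qed.

Lemma hits_split U V f : V \subset U -> hits U f = (hits V f + hits (U :\: V) f)%N.
Proof.
move=> VU; rewrite /hits -big_split /=; apply: eq_bigr => v _; rewrite finset.in_setD.
by case: (boolP (f v \in V)) => //= fV; rewrite (fintype.subsetP VU).
Qed.

Lemma density_split U V : V \subset U -> density U = density V + density (U :\: V).
Proof.
move=> VU; rewrite /density -mulrDl -natrD cardsD (finset.setIidPr VU) subnKC //.
exact: subset_leq_card.
Qed.

Lemma density_le1 U : density U <= 1.
Proof. by rewrite /density ler_pdivrMr ?ltr0n // mul1r ler_nat max_card. Qed.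

Section Chain.
Variables (rho : C -> nat) (K T : nat).
Hypothesis K0 : (0 < K)%N.
Let level s := [set c | rho c <= s]%N.
(** The density of a level, rounded down to a multiple of 1 / K. The coarse levels are the first
    ones to reach each class, so a level exceeds its coarse level by density at most 1 / K. *)
Let class s := (K * #|level s| %/ #|C|)%N.
Let base k := find (fun s => k <= class s)%N (iota 0 T).

Lemma level_sub s s' : (s <= s')%N -> level s \subset level s'.
Proof. by move=> ss; apply/fintype.subsetP => c; rewrite !inE => /leq_trans; apply. Qed.

Lemma class_le s : (class s <= K)%N.
Proof. by rewrite /class -[leqRHS](mulnK K C0) leq_div2r // leq_mul2l max_card orbT. Qed.

Lemma base_spec s : (s < T)%N -> (base (class s) <= s)%N /\
  (K * #|level s :\: level (base (class s))| <= #|C|)%N.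
Proof.
move=> sT; set k := class s; set b := base k.
have hs : has (fun s => k <= class s)%N (iota 0 T).
  by apply/hasP; exists s => //; rewrite mem_iota.
have bs : (b <= s)%N.
  rewrite leqNgt; apply/negP => sb.
  have := before_find 0%N sb; rewrite nth_iota // add0n => /negP; apply; exact: leqnn.
split=> //.
have kb : (k <= class b)%N.
  have := nth_find 0%N hs; rewrite nth_iota ?add0n //.
  by rewrite -[X in (_ < X)%N](size_iota 0 T) -has_find.
rewrite cardsD (finset.setIidPr (level_sub bs)) mulnBr.
have h1 : (K * #|level s| < k.+1 * #|C|)%N by rewrite -ltn_divLR.
have h2 : (k * #|C| <= K * #|level b|)%N by rewrite -leq_divRL.
lia.
Qed.

(* A fixed number [K + 1] of coarse levels, plus all the fine levels, each at
   relative distance at most [1 / K] above a coarse one: the variance between the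
   two is so small that a union bound over all the fine levels is affordable. *)
Lemma chain_deviation (x y t : R) : 0 <= x <= 1 / 2 -> 0 <= y <= 1 / 2 ->
  fraction R (\bigcup_(s < T) deviates (level s) (2 * t)) <=
  K.+1%:R * (2 * expR (2 * n%:R * x ^+ 2 - x * t)) +
  T%:R * (2 * expR (2 * n%:R / K%:R * y ^+ 2 - y * t)).
Proof.
move=> hx hy.
pose A := \bigcup_(k < K.+1) deviates (level (base k)) t.
pose B := \bigcup_(s < T) deviates (level s :\: level (base (class s))) t.
apply: le_trans (fraction_sub (B := A :|: B) _ _) _.
  apply/fintype.subsetP => f /finset.bigcupP[s _]; rewrite inE => hf; rewrite finset.in_setU.
  have [bs _] := base_spec (ltn_ord s); have sub := level_sub bs.
  move: hf; rewrite (hits_split _ sub) (density_split sub) natrD mulrDr opprD addrACA => hf.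
  have := le_trans hf (ler_normD _ _) => {}hf.
  have [h|h] := lerP t `|(hits (level (base (class s))) f)%:R - n%:R * density (level (base (class s)))|.
    apply/orP; left; have ck : (class s < K.+1)%N by rewrite ltnS class_le.
    by apply/finset.bigcupP; exists (Ordinal ck) => //; rewrite inE.
  apply/orP; right; apply/finset.bigcupP; exists s => //; rewrite inE; lra.
apply: le_trans (fractionU _ _ _) (lerD _ _).
  apply: le_trans (fraction_bigcup _ _ _) _.
  rewrite mulr_natl -[X in _ *+ X]card_ord -sumr_const; apply: ler_sum => k _.
  apply: le_trans (chernoff _ _ hx) _; rewrite ler_pM2l // ler_expR lerB //.
  rewrite -mulrA ler_wpM2l ?mulr_ge0 // -[leRHS]mul1r ler_wpM2r ?sqr_ge0 //.
  exact: density_le1.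
apply: le_trans (fraction_bigcup _ _ _) _.
rewrite mulr_natl -[X in _ *+ X]card_ord -sumr_const; apply: ler_sum => s _.
apply: le_trans (chernoff _ _ hy) _; rewrite ler_pM2l // ler_expR lerB //.
rewrite ler_wpM2r ?sqr_ge0 // ler_wpM2l ?mulr_ge0 //.
have [_ H] := base_spec (ltn_ord s).
rewrite /density ler_pdivrMr ?ltr0n // mulrC ler_pdivlMr ?ltr0n //.
by rewrite -natrM ler_nat mulnC.
Qed.

End Chain.
End Chernoff.

Lemma count_iota_sum (p : pred nat) m : (count p (iota 0 m) = \sum_(j < m) p j)%N.
Proof.
rewrite -sum1_count -{1}(subn0 m) -/(index_iota 0 m) big_mkcond /= big_mkord.
by apply: eq_bigr => j _; case: (p j).
Qed.

(** * The bad event for random assignments of cells *)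

Section GridEvent.
Variables (R : realType) (n M : nat).
Let C := ('I_M * 'I_M)%type.
Let F := {ffun 'I_n -> C}.

Definition cell_corner_key (k : bool * bool) (c : C) : nat :=
  (cidx M k.1 c.1 * cidx M k.1 c.1 + cidx M k.2 c.2 * cidx M k.2 c.2)%N.
Definition corner_disc (k : bool * bool) (s : nat) : {set C} :=
  [set c | cell_corner_key k c <= s]%N.

Definition cellx (f : F) (v : nat) : nat := if insub v is Some i then (f i).1 else 0%N.
Definition celly (f : F) (v : nat) : nat := if insub v is Some i then (f i).2 else 0%N.

Lemma cellE (f : F) (v : 'I_n) : cellx f v = (f v).1 /\ celly f v = (f v).2.
Proof. by rewrite /cellx /celly valK. Qed.

Lemma count_corner_disc k s (f : F) :
  count (fun v => corner_key M (cellx f) (celly f) k v <= s)%N (iota 0 n) =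
  hits (corner_disc k s) f.
Proof.
rewrite count_iota_sum; apply: eq_bigr => v _.
by rewrite /corner_key (cellE f v).1 (cellE f v).2 inE.
Qed.

Lemma sum_cidx (h : nat -> nat) b : (\sum_(i < M) h (cidx M b i) = \sum_(i < M) h i)%N.
Proof.
case: b => //=; rewrite (reindex_inj rev_ord_inj) /=.
apply: eq_bigr => i _; congr h; rewrite /cidx; have := ltn_ord i; lia.
Qed.

Lemma card_corner_disc k s : #|corner_disc k s| = disc_count M s.
Proof.
rewrite disc_count_rows big_mkord.
transitivity (\sum_(i < M) \sum_(j < M)
    (cidx M k.1 i * cidx M k.1 i + cidx M k.2 j * cidx M k.2 j <= s)%N)%N.
  rewrite pair_bigA /= -sum1_card big_mkcond /=; apply: eq_bigr => c _.
  by rewrite inE /cell_corner_key; case: (_ <= s)%N.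
rewrite (sum_cidx (fun i => \sum_(j < M) (i * i + cidx M k.2 j * cidx M k.2 j <= s)%N)%N).
apply: eq_bigr => i _.
rewrite (sum_cidx (fun j => nat_of_bool (i * i + j * j <= s)%N)).
by rewrite /row_count count_iota_sum.
Qed.

Definition empty_disc (k : bool * bool) (s : nat) : {set F} :=
  [set f | hits (corner_disc k s) f == 0%N].

Definition bad (t : R) (B : nat) : {set F} :=
  \bigcup_(k : bool * bool)
    ((\bigcup_(s < M * M + M * M) deviates n (corner_disc k s) t) :|:
     empty_disc k (2 * (B * B))).

Lemma bad_fraction (c S lam : R) (K B : nat) : 0 < c -> (0 < K)%N -> 18 <= K%:R * c ^+ 2 ->
  (0 < M)%N -> (M * M <= n)%N -> (B <= M)%N -> 0 < S -> S ^+ 2 = n%:R -> 0 <= lam ->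
  lam ^+ 2 = ln n%:R -> c * lam <= 2 * S -> 6 * lam <= c * S ->
  (c * lam) ^+ 2 <= B%:R ^+ 2 ->
  fraction R (bad (2 * (c * lam * S)) B) <=
    (8 * K + 16)%N%:R * expR (- (c * lam) ^+ 2 / 8) + 16 * expR (- lam ^+ 2).
Proof.
move=> c0 K0 Kc M0 Mn BM S0 Sn l0 ln_n h1 h2 hB.
have n0 : 0 < n%:R :> R by rewrite -Sn exprn_gt0.
have nE : n%:R = expR (lam ^+ 2) :> R by rewrite ln_n lnK.
have C0 : (0 < #|{: C}|)%N by rewrite card_prod !card_ord muln_gt0 M0.
have cardC : #|{: C}| = (M * M)%N by rewrite card_prod !card_ord.
set e1 := expR (- (c * lam) ^+ 2 / 8); set e2 := expR (- lam ^+ 2).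
have dev k : fraction R (\bigcup_(s < M * M + M * M) deviates n (corner_disc k s) (2 * (c * lam * S))) <=
    (2 * K + 2)%N%:R * e1 + 4 * e2.
  (* [x] minimises the coarse exponent, which becomes - (c lam)^2 / 8. With K c^2 at least 18, [y]
     makes the fine exponent at most - 2 lam^2; exp(- 2 lam^2) = n^-2 outweighs the number 2 M^2 of
     levels. *)
  pose x := c / 4 * (lam / S); pose y := 3 / c * (lam / S).
  have lS : 0 <= lam / S by rewrite divr_ge0 // ltW.
  have hx : 0 <= x <= 1 / 2.
    apply/andP; split; first by rewrite /x mulr_ge0 // divr_ge0 // ltW.
    by rewrite /x mulrA ler_pdivrMr //; lra.
  have hy : 0 <= y <= 1 / 2.
    apply/andP; split; first by rewrite /y mulr_ge0 // divr_ge0 // ltW.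
    by rewrite /y mulrA ler_pdivrMr // mulrAC ler_pdivrMr //; lra.
  apply: le_trans (@chain_deviation R n _ C0 (cell_corner_key k) K (M * M + M * M) K0 x y (c * lam * S) hx hy) _.
  have Sne : S != 0 by rewrite gt_eqF.
  have cne : c != 0 by rewrite gt_eqF.
  have Kpos : 0 < K%:R :> R by rewrite ltr0n.
  have -> : 2 * n%:R * x ^+ 2 - x * (c * lam * S) = - (c * lam) ^+ 2 / 8.
    by rewrite -Sn /x; field.
  have -> : 2 * n%:R / K%:R * y ^+ 2 - y * (c * lam * S) = 18 / (K%:R * c ^+ 2) * lam ^+ 2 - 3 * lam ^+ 2.
    by rewrite -Sn /y; field; rewrite cne gt_eqF.
  have E2 : expR (18 / (K%:R * c ^+ 2) * lam ^+ 2 - 3 * lam ^+ 2) <= e2 * e2.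
    rewrite -expRD ler_expR.
    have : 18 / (K%:R * c ^+ 2) * lam ^+ 2 <= 1 * lam ^+ 2.
      rewrite ler_wpM2r ?sqr_ge0 // ler_pdivrMr ?mul1r //.
      by rewrite mulr_gt0 // exprn_gt0.
    by lra.
  have nE2 : (M * M)%:R * e2 <= 1.
    apply: le_trans (_ : n%:R * e2 <= _); first by rewrite ler_wpM2r ?expR_ge0 // ler_nat.
    by rewrite nE -expRD subrr expR0.
  have e20 : 0 <= e2 by rewrite expR_ge0.
  apply: lerD.
    by rewrite -/e1 natrD natrM -natr1; lra.
  rewrite natrD; set m := (M * M)%:R in nE2 *.
  have m0 : 0 <= m by rewrite /m.
  have : m * expR (18 / (K%:R * c ^+ 2) * lam ^+ 2 - 3 * lam ^+ 2) <= m * (e2 * e2).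
    by rewrite ler_wpM2l.
  have : m * (e2 * e2) <= 1 * e2 by rewrite mulrA ler_wpM2r.
  lra.
have emp k : fraction R (empty_disc k (2 * (B * B))) <= 2 * e1.
  pose U := corner_disc k (2 * (B * B)).
  have nq : B%:R ^+ 2 <= n%:R * density R U.
    rewrite /density cardC /U card_corner_disc.
    have m0 : 0 < (M * M)%:R :> R by rewrite ltr0n muln_gt0 M0.
    rewrite mulrA ler_pdivlMr // -natrX -!natrM ler_nat mulnC.
    by rewrite -mulnn leq_mul // disc_count_lower.
  have h4 : ((0 : R) <= 1 / 4) && (1 / 4 <= 1 / 2 :> R).
    by apply/andP; split; lra.
  apply: le_trans (fraction_sub _ (B := deviates n U (n%:R * density R U)) _) _.
    apply/fintype.subsetP => f; rewrite !inE => /eqP ->.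
    by rewrite sub0r normrN ger0_norm // mulr_ge0 // divr_ge0.
  (* An empty disc deviates by its whole mean n q, for which 1/4 gives the exponent - n q / 8. *)
  apply: le_trans (@chernoff R n _ C0 U (1 / 4) _ h4) _; rewrite ler_pM2l // ler_expR.
  by move: nq; move: (density R U) => q nq; lra.
apply: le_trans (fraction_bigcup _ _ _) _.
apply: le_trans (ler_sum _ (fun k _ => le_trans (fractionU _ _ _) (lerD (dev k) (emp k)))) _.
rewrite sumr_const card_prod card_bool -[leLHS]mulr_natl.
have -> : (2 * K + 2)%:R = 2 * K%:R + 2 :> R by rewrite natrD natrM.
have -> : (8 * K + 16)%:R = 8 * K%:R + 16 :> R by rewrite natrD natrM.
by rewrite (_ : (2 * 2)%N = 4%N) //; lra.
Qed.

End GridEvent.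

Local Open Scope classical_set_scope.
Local Open Scope ring_scope.

(** * From the measure to the uniform distribution on cells *)

Lemma bigsetU_elim (T : Type) N (G : 'I_N -> set T) x :
  (\big[setU/set0]_(i < N) G i) x -> exists i, G i x.
Proof.
elim/big_ind: _ => // [A B HA HB [/HA|/HB]|i _ Gx]; [exact: id|exact: id|by exists i].
Qed.

Section Discretization.
Variables (R : realType) (n M : nat).
Let S : R := Num.sqrt n%:R.
Let h : R := S / 2.
Let w : R := S / M%:R.
Let C := ('I_M * 'I_M)%type.
Let F := {ffun 'I_n -> C}.
Hypotheses (n0 : (0 < n)%N) (M0 : (0 < M)%N).

(** Half-open intervals make the boxes disjoint; they leave out two edges of the square. *)
Definition slab (i : nat) : set R := `[- h + i%:R * w, - h + i.+1%:R * w[.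
Definition box (c : C) : set (R * R) := slab c.1 `*` slab c.2.

Let S0 : 0 < S.
Proof. by rewrite sqrtr_gt0 ltr0n. Qed.

Let w0 : 0 < w.
Proof. by rewrite divr_gt0 // ltr0n. Qed.

Lemma slabP i x : slab i x <-> - h + i%:R * w <= x < - h + i.+1%:R * w.
Proof. by rewrite /slab /= in_itv. Qed.

Lemma slab_inj i j x : slab i x -> slab j x -> i = j.
Proof.
move=> /slabP/andP[i1 i2] /slabP/andP[j1 j2].
have aux a b : - h + a%:R * w <= x -> x < - h + b.+1%:R * w -> (a <= b)%N.
  move=> a1 b2; have : a%:R * w < b.+1%:R * w by lra.
  by rewrite ltr_pM2r // ltr_nat ltnS.
by apply/eqP; rewrite eqn_leq !aux.
Qed.

Lemma slab_measure i : lebesgue_measure (slab i) = w%:E.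
Proof.
rewrite /slab lebesgue_measure_itv /= lte_fin -natr1.
have -> : - h + i%:R * w < - h + (i%:R + 1) * w.
  by rewrite ltrD2l mulrDl mul1r ltrDl.
by rewrite -EFinD; congr EFin; ring.
Qed.

Lemma box_measurable c : measurable (box c).
Proof. by apply: measurableX; exact: measurable_itv. Qed.

Lemma box_sub c : box c `<=` @Sn R n.
Proof.
have SM : S = M%:R * w by rewrite /w mulrC divfK // gt_eqF // ltr0n.
have aux (i : 'I_M) x : slab i x -> `|x| <= S / 2.
  move=> /slabP/andP[x1 x2].
  have i1 : i.+1%:R <= M%:R :> R by rewrite ler_nat.
  have i0 : 0 <= i%:R :> R by [].
  have h1 : i.+1%:R * w <= S by rewrite SM ler_wpM2r // ltW.
  have h2 : 0 <= i%:R * w by rewrite mulr_ge0 // ltW.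
  by rewrite ler_norml; apply/andP; split; rewrite /h in x1 x2; lra.
by move=> p [/aux p1 /aux p2]; split.
Qed.

Lemma box_measure c :
  ((lebesgue_measure \x lebesgue_measure) (box c `&` @Sn R n) * (n%:R^-1)%:E)%E =
  ((M * M)%:R^-1)%:E.
Proof.
rewrite (setIidl (@box_sub c)) /box product_measure1E; try exact: measurable_itv.
transitivity (lebesgue_measure (slab c.1) * lebesgue_measure (slab c.2) * (n%:R^-1)%:E)%E; first by [].
rewrite !slab_measure -!EFinM; congr EFin.
have Sn : n%:R = S * S :> R by rewrite -expr2 sqr_sqrtr.
rewrite Sn /w natrM; field.
by rewrite pnatr_eq0 -lt0n M0 gt_eqF.
Qed.

Variables (d : measure_display) (T : measurableType d) (P : probability T R).
Variable X : nat -> T -> R * R.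
Hypothesis iid : iid_uniform_Sn P n X.

Definition in_cells (f : F) : set T :=
  [set x | forall v : 'I_n, box (f v) (X v x)].

(** The independence hypothesis takes a family indexed by all natural numbers, so the boxes are
    continued by the full space. *)
Let boxn (f : F) (v : nat) : set (R * R) := if insub v is Some i then box (f i) else setT.

Lemma in_cellsE f : in_cells f = \bigcap_(v in [set v | (v < n)%N]) (X v @^-1` boxn f v).
Proof.
apply/seteqP; split => x /= H.
- by move=> v vn; rewrite /boxn /preimage /= insubT; exact: (H (Ordinal vn)).
- by move=> v; have := H v (ltn_ord v); rewrite /boxn /preimage /= valK.
Qed.

Lemma in_cells_measurable f : measurable (in_cells f).
Proof.
rewrite in_cellsE; apply: fin_bigcap_measurable; first exact: finite_II.
move=> v /= vn; have [mX _] := iid.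
rewrite -[X in measurable X]setTI; apply: mX => //.
by rewrite /boxn; case: insubP => [i _ _|//]; exact: box_measurable.
Qed.

Lemma in_cells_measure f : P (in_cells f) = (((M * M) ^ n)%N%:R^-1)%:E.
Proof.
have [mX [unifX indX]] := iid.
rewrite in_cellsE indX; last first.
  by move=> v; rewrite /boxn; case: insubP => [i _ _|_]; [exact: box_measurable|exact: measurableT].
rewrite (eq_bigr (fun=> ((M * M)%:R^-1)%:E)); last first.
  move=> v _; rewrite unifX //; last first.
    by rewrite /boxn valK; exact: box_measurable.
  by rewrite /boxn valK box_measure.
by rewrite prodEFin prodr_const card_ord natrX exprVn.
Qed.

Lemma in_cells_disjoint f g x : in_cells f x -> in_cells g x -> f = g.
Proof.
move=> fx gx; apply/ffunP => v; have [f1 f2] := fx v; have [g1 g2] := gx v.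
rewrite [LHS]surjective_pairing [RHS]surjective_pairing.
by congr pair; apply: val_inj; [exact: slab_inj f1 g1 | exact: slab_inj f2 g2].
Qed.

(** [E] is the complement of the good assignments rather than the union of the bad ones, so it also
    holds the outcomes with a point in no box. As all assignments are equally likely, its
    probability is still exactly the fraction of bad ones. *)
Lemma discretization (B : {set F}) : exists E : set T,
  [/\ measurable E, (forall x, ~ E x -> exists2 f, f \notin B & in_cells f x) &
      P E = (fraction R B)%:E].
Proof.
pose G : {set F} := (~: B)%SET.
pose U := \big[setU/set0]_(i < #|G|) in_cells (enum_val i).
have mU : measurable U by apply: bigsetU_measurable => i _; exact: in_cells_measurable.
have PU : P U = (#|G|%:R * ((M * M) ^ n)%N%:R^-1)%:E.
  rewrite /U measure_bigsetU_ord //; first last.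
  - move=> i j _ _ [x [xi xj]]; apply: enum_val_inj; exact: in_cells_disjoint xi xj.
  - by move=> i; exact: in_cells_measurable.
  rewrite (eq_bigr (fun=> (((M * M) ^ n)%N%:R^-1)%:E)); last by move=> i _; exact: in_cells_measure.
  by rewrite sumEFin sumr_const card_ord mulr_natl.
exists (~` U); split.
- exact: measurableC.
- move=> x xE; have Ux : U x by apply: contrapT.
  have [i xi] := bigsetU_elim Ux.
  exists (enum_val i) => //.
  by have := enum_valP i; rewrite finset.in_setC.
- rewrite probability_setC // PU -EFinB; congr EFin.
  rewrite /fraction card_ffun card_prod !card_ord.
  have N0 : ((M * M) ^ n)%N%:R != 0 :> R by rewrite pnatr_eq0 -lt0n expn_gt0 muln_gt0 M0.
  have : #|B|%:R + #|G|%:R = ((M * M) ^ n)%N%:R :> R.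
    by rewrite -natrD cardsC card_ffun card_prod !card_ord.
  move=> sumE; rewrite -sumE in N0 *.
  by rewrite -{1}(divff N0) -mulrBl addrK.
Qed.

End Discretization.

(** * Conclusion *)

Lemma isqrt_exists n : exists2 M, (M * M <= n)%N & (n < M.+1 * M.+1)%N.
Proof.
elim: n => [|n [M M1 M2]]; first by exists 0%N.
by have [le|lt] := leqP (M.+1 * M.+1) n.+1; [exists M.+1 => //; nia | exists M => //; lia].
Qed.

Lemma run_halted (R : realType) prog (X : nat -> R * R) n k c :
  halted prog X n c -> run prog X n k c = c.
Proof. by rewrite /halted; case: k => //= k ->. Qed.

Lemma embed_halted (R : realType) (X : nat -> R * R) n N F :
  halted embed_prog X n (Config (size (code 0 embed)) N F).
Proof.
have E : nth Halt embed_prog (size (code 0 embed)) = Halt.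
  by rewrite /embed_prog nth_cat ltnn subnn.
by rewrite /halted /step; cbn [pc]; rewrite E.
Qed.

Lemma embed_linear (R : realType) : @linear_time R embed_prog.
Proof.
exists 500%N => n X; have [M M1 M2] := isqrt_exists n.
have [k [N [F [kn E _]]]] := embed_spec X M1 M2.
have kn' : (k <= 500 * n.+1)%N by lia.
rewrite /halts_within -(subnKC kn') run_add E run_halted; exact: embed_halted.
Qed.

Lemma dstar_le (R : realType) n (Phi1 Phi2 : nat -> R * R) i : (i < 8)%N ->
  dstar n Phi1 Phi2 <= dmax n (nth (fun p => p) (sq_syms R) i) Phi1 Phi2.
Proof.
rewrite /dstar -[8%N]/(size (sq_syms R)); elim: (sq_syms R) i => // s l IH [|i] il /=.
  by rewrite ge_min lexx.
by rewrite ge_min IH ?orbT.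
Qed.

Lemma dmax_lt (R : realType) n s (Phi1 Phi2 : nat -> R * R) (r : R) : 0 < r ->
  (forall v, (v < n)%N -> dist2 (s (Phi1 v)) (Phi2 v) < r) -> dmax n s Phi1 Phi2 < r.
Proof.
by move=> r0 H; rewrite /dmax; apply/bigmax_ltP; split=> // v _; exact: H.
Qed.

Lemma natr_error (R : pzSemiRingType) e t M :
  (e + 20 * t + 20 * M + 1)%N%:R = e%:R + 20 * t%:R + 20 * M%:R + 1 :> R.
Proof. by rewrite 3!natrD 2!natrM. Qed.

Lemma dist2_lt_of_half (R : realType) (p q : R * R) (r : R) : 0 < r ->
  - (r / 2) <= p.1 - q.1 -> p.1 - q.1 <= r / 2 ->
  - (r / 2) <= p.2 - q.2 -> p.2 - q.2 <= r / 2 -> dist2 p q < r.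
Proof.
rewrite /dist2; move: (p.1 - q.1) (p.2 - q.2) => a b r0 a1 a2 b1 b2.
rewrite -[ltRHS]ger0_norm ?ltW // -sqrtr_sqr ltr_sqrt ?exprn_gt0 //; nra.
Qed.

(** * The error of the embedding outside the bad event *)

Section Success.
Variables (R : realType) (n M B : nat) (c lam : R).
Let S : R := Num.sqrt n%:R.
Hypotheses (Mn : (M * M <= n)%N) (nM : (n < M.+1 * M.+1)%N).
(** Each coordinate will have error at most 4 + 900 + 600 c lam = 904 + 0.3 lam, which is below lam
    / 2 for lam at least 5000. The bound on S keeps the relative errors below 1/100. *)
Hypothesis scales : [/\ c = 1 / (20 * 100), 50 * 100 <= lam, 120 * 100 * lam <= S,
  c * lam <= B%:R & B%:R <= c * lam + 1].

Let SM1 : S <= M%:R + 1.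
Proof.
have -> : M%:R + 1 = Num.sqrt (M.+1%:R ^+ 2) :> R by rewrite sqrtr_sqr ger0_norm // -natr1.
by apply: ler_wsqrtr; rewrite -natrX ler_nat -mulnn ltnW.
Qed.

Let M_big : 110 * 100 * lam <= M%:R.
Proof. by have [_ lam_big S_big _ _] := scales; have := SM1; lra. Qed.

Lemma grid_large : [/\ (4 < M)%N, (B <= M)%N & (100 * (2 * B + 1) <= 3 * M)%N].
Proof.
have [cE lam_big _ _ B2] := scales.
split; first by rewrite -(ltr_nat R); have := M_big; lra.
  by rewrite -(ler_nat R); have := M_big; rewrite cE in B2; lra.
rewrite -(ler_nat R) !natrM natrD natrM; have := M_big; rewrite cE in B2; lra.
Qed.

(** The expected count is (n / M^2) L(s); replacing it by L(s) costs at most n - M^2, hence the term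
    2 M. *)
Lemma good_count (f : {ffun 'I_n -> 'I_M * 'I_M}) t k s :
  2 * (c * lam * S) + 2 * M%:R <= t%:R ->
  f \notin bad n M (2 * (c * lam * S)) B -> (s < M * M + M * M)%N ->
  (hits (corner_disc M k s) f <= disc_count M s + t)%N /\
  (disc_count M s <= hits (corner_disc M k s) f + t)%N.
Proof.
have [cE lam_big _ _ _] := scales.
move=> ht fB sm; have [M4 _ _] := grid_large.
have : `|(hits (corner_disc M k s) f)%:R - n%:R * density R (corner_disc M k s)| < 2 * (c * lam * S).
  rewrite ltNge; apply/negP => dev; move/negP: fB; apply.
  apply/finset.bigcupP; exists k => //; rewrite finset.in_setU; apply/orP; left.
  by apply/finset.bigcupP; exists (Ordinal sm) => //; rewrite inE.
rewrite /density card_corner_disc card_prod !card_ord ltr_norml => /andP[d1 d2].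
have m0 : 0 < (M * M)%:R :> R by rewrite ltr0n muln_gt0 andbb (leq_trans _ M4).
set D : R := n%:R * _ in d1 d2.
have DE : D * (M * M)%:R = n%:R * (disc_count M s)%:R.
  by rewrite /D mulrA divfK // gt_eqF.
have dm : (disc_count M s)%:R <= (M * M)%:R :> R by rewrite ler_nat disc_count_le.
have D1 : (disc_count M s)%:R <= D.
  rewrite -(ler_pM2r m0) DE mulrC ler_wpM2r // ler_nat //.
have n2 : n%:R <= (M * M)%:R + 2 * M%:R :> R.
  by rewrite -natrM -natrD ler_nat; move: nM; clear; lia.
have D2 : D <= (disc_count M s)%:R + 2 * M%:R.
  rewrite -(ler_pM2r m0) DE mulrDl.
  have d0 : 0 <= (disc_count M s)%:R :> R by [].
  have M20 : 0 <= 2 * M%:R :> R by rewrite mulr_ge0.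
  have h1 : n%:R * (disc_count M s)%:R <= ((M * M)%:R + 2 * M%:R) * (disc_count M s)%:R :> R.
    by apply: ler_wpM2r.
  have h2 : 2 * M%:R * (disc_count M s)%:R <= 2 * M%:R * (M * M)%:R :> R by apply: ler_wpM2l.
  by apply: le_trans h1 _; rewrite mulrDl [_ * (disc_count M s)%:R]mulrC lerD2l.
by split; rewrite -(ler_nat R) natrD; lra.
Qed.

Lemma good_succeeds (X : nat -> R * R) (f : {ffun 'I_n -> 'I_M * 'I_M}) :
  (forall v : 'I_n, box n (f v) (X v)) -> f \notin bad n M (2 * (c * lam * S)) B ->
  succeeds embed_prog X n (1197%:R / 1000%:R * lam).
Proof.
have [cE lam_big S_big B1 B2] := scales; have sm1 := SM1.
move=> fX fB; have [M4 BM Be] := grid_large.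
have Mpos : (0 < M)%N by exact: leq_trans M4.
have M0 : 0 < M%:R :> R by rewrite ltr0n.
have n0 : (0 < n)%N by apply: leq_trans Mn; rewrite muln_gt0 Mpos.
have lam0 : 0 < lam by lra.
have S0 : 0 < S by lra.
pose w : R := S / M%:R.
have SE : S = M%:R * w by rewrite /w mulrC divfK // gt_eqF.
have M1 : 1 <= M%:R :> R by rewrite ler1n.
have w2 : w <= 2 by rewrite /w ler_pdivrMr //; lra.
have w0 : 0 < w by rewrite /w divr_gt0.
have S2 : S <= 2 * M%:R by lra.
pose e := (Num.truncn (8 * S * (w + 8 * ((2 * B + 1)%N%:R * w)))).+1.
pose t := ((Num.truncn (2 * (c * lam * S))).+1 + 2 * M)%N.
have c0 : 0 < c by rewrite cE; lra.
have cl0 : 0 < c * lam by rewrite mulr_gt0.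
have clS : 0 <= 2 * (c * lam * S) by rewrite !mulr_ge0 // ltW.
have e0 : 0 <= 8 * S * (w + 8 * ((2 * B + 1)%N%:R * w)).
  by rewrite mulr_ge0 ?addr_ge0 ?mulr_ge0 // ltW.
have /andP[e1 e2] := truncn_itv e0; have /andP[t1 t2] := truncn_itv clS.
have he : 8 * S * (w + 8 * ((2 * B + 1)%N%:R * w)) <= e%:R by rewrite ltW.
have ht : 2 * (c * lam * S) + 2 * M%:R <= t%:R by rewrite /t natrD natrM lerD2r ltW.
(* From w S <= 4 M and B <= c lam + 1 comes 32 M (9 + 16 (c lam + 1)) = M (800 + 512 c lam). *)
have e_le : e%:R <= M%:R * (800 + 512 * (c * lam)) + 1.
  rewrite /e -natr1; apply: lerD => //; apply: le_trans e1 _.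
  rewrite natrD natrM.
  have b0 : 0 <= B%:R :> R by [].
  have h1 : 8 * S * (w + 8 * ((2 * B%:R + 1) * w)) = 8 * (w * S) * (9 + 16 * B%:R) by ring.
  rewrite h1; have h2 : w * S <= 4 * M%:R.
    by apply: le_trans (_ : 2 * (2 * M%:R) <= _); [apply: ler_pM => //; exact: ltW | lra].
  have h3 : 8 * (w * S) * (9 + 16 * B%:R) <= 8 * (4 * M%:R) * (9 + 16 * (c * lam + 1)).
    have wS0 : 0 <= w * S by rewrite mulr_ge0 ?(ltW w0) ?(ltW S0).
    by apply: ler_pM; lra.
  by apply: le_trans h3 _; lra.
have t_le : t%:R <= 4 * (c * lam) * M%:R + 1 + 2 * M%:R.
  rewrite /t natrD natrM -natr1 lerD2r lerD2r; apply: le_trans t1 _.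
  have : c * lam * S <= c * lam * (2 * M%:R) by rewrite ler_wpM2l // ltW.
  by lra.
have E_le : (e + 20 * t + 20 * M + 1)%N%:R <= M%:R * (900 + 600 * (c * lam)).
  have xM : 0 <= c * lam * M%:R by rewrite mulr_ge0 // ltW.
  by rewrite natr_error; move: (e%:R) (t%:R) e_le t_le => e' t' *; lra.
have HE : (100 * (e + 20 * t + 20 * M + 1) <= M * M)%N.
  rewrite -(ler_nat R) [leLHS]natrM natrM.
  have h1 : 100 * (900 + 600 * (c * lam)) <= M%:R by have := M_big; rewrite cE; lra.
  have h2 := ler_wpM2l (ltW M0) h1.
  by apply: le_trans (ler_wpM2l _ E_le) _ => //; lra.
have cells v : (v < n)%N -> [/\ (cellx f v < M)%N, (celly f v < M)%N,
      - (S / 2) + (cellx f v)%:R * (S / M%:R) <= (X v).1 < - (S / 2) + (cellx f v).+1%:R * (S / M%:R) &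
      - (S / 2) + (celly f v)%:R * (S / M%:R) <= (X v).2 < - (S / 2) + (celly f v).+1%:R * (S / M%:R)].
  move=> vn; have [s1 s2] := fX (Ordinal vn).
  have [-> ->] := cellE f (Ordinal vn).
  by split=> //; exact/slabP.
have counts k s : (s < M * M + M * M)%N ->
    (count (fun v => corner_key M (cellx f) (celly f) k v <= s)%N (iota 0 n) <= disc_count M s + t)%N /\
    (disc_count M s <= count (fun v => corner_key M (cellx f) (celly f) k v <= s)%N (iota 0 n) + t)%N.
  by rewrite count_corner_disc; exact: good_count.
have occupied k : exists2 q, (q < n)%N & (corner_key M (cellx f) (celly f) k q <= 2 * (B * B))%N.
  have : (0 < count (fun v => corner_key M (cellx f) (celly f) k v <= 2 * (B * B))%N (iota 0 n))%N.
    rewrite count_corner_disc lt0n; apply/negP => h0; move/negP: fB; apply.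
    by apply/finset.bigcupP; exists k => //; rewrite finset.in_setU inE; apply/orP; right.
  by rewrite -has_count => /hasP[q]; rewrite mem_iota => /andP[_ qn] hq; exists q.
have [k [N [F [_ E [z Z HF]]]]] := embed_spec X Mn nM.
have [i i8 close] := embedding_close M4 Mn nM cells counts occupied Be he HE Z n0.
exists k; split; first by rewrite /halts_within E; exact: embed_halted.
rewrite E; set o := output _.
have out : forall v, (v < n)%N -> o v = _ := HF.
clearbody o.
(* The error is shown to be below [lam]; the constant 1.197 enters only through this comparison. *)
have lam_r : lam <= 1197%:R / 1000%:R * lam.
  rewrite -[leLHS]mul1r; apply: ler_wpM2r; first exact: ltW.
  rewrite ler_pdivlMr; last by rewrite ltr0n.
  by rewrite mul1r ler_nat.
move: (1197%:R / 1000%:R * lam) lam_r => r lam_r.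
apply: le_lt_trans (dstar_le n X o i8) _; apply: dmax_lt; first exact: lt_le_trans lam_r.
move=> v vn; rewrite out //.
have := close v vn; move: (nth _ _ _ _) => p.
have bound : 4 + (e + 20 * t + 20 * M + 1)%N%:R / M%:R <= lam / 2.
  have : (e + 20 * t + 20 * M + 1)%N%:R / M%:R <= 900 + 600 * (c * lam).
    by rewrite ler_pdivrMr // mulrC.
  by rewrite cE; lra.
move: bound; move: (4 + _ / _) => b4 bound.
move: (coord _ _ _ _ _ _) (coord _ _ _ _ _ _) => y x [h1 h2].
have := le_trans h1 bound; have := le_trans h2 bound.
rewrite !ler_norml => /andP[q1 q2] /andP[p1 p2].
by apply: lt_le_trans lam_r; exact: (@dist2_lt_of_half _ p (x, y) lam lam0 p1 p2 q1 q2).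
Qed.

End Success.

(** * Asymptotics and choice of the constants *)

Lemma expRN_le_inv (R : realType) (y : R) : 0 < y -> expR (- y) <= y^-1.
Proof.
move=> y0; rewrite expRN lef_pV2 ?posrE ?expR_gt0 //.
by apply: le_trans (expR_ge1Dx y); lra.
Qed.

Lemma sqrt_ln_eventually (R : realType) (L : R) : exists N : nat, forall n : nat, (N <= n)%N ->
  [/\ (0 < n)%N, L <= Num.sqrt (ln (n%:R : R)) & Num.sqrt (ln (n%:R : R)) ^+ 2 = ln n%:R].
Proof.
exists (Num.truncn (expR (L ^+ 2))).+1 => n Nn.
have n0 : (0 < n)%N by exact: leq_ltn_trans Nn.
have nE : expR (L ^+ 2) <= n%:R.
  by apply: ltW; apply: lt_le_trans (truncnS_gt _) _; rewrite ler_nat.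
have l2 : L ^+ 2 <= ln n%:R.
  by rewrite -[leLHS]expRK ler_ln ?posrE ?expR_gt0 ?ltr0n.
split=> //.
  apply: le_trans (ler_norm L) _; rewrite -sqrtr_sqr; exact: ler_wsqrtr.
by rewrite sqr_sqrtr // (le_trans _ l2) // sqr_ge0.
Qed.

Lemma sqrt_exp_lower (R : realType) (n : nat) (lam : R) : (0 < n)%N -> lam ^+ 2 = ln n%:R ->
  lam ^+ 2 / 2 <= Num.sqrt n%:R.
Proof.
move=> n0 lE; have -> : n%:R = expR (lam ^+ 2 / 2) ^+ 2 :> R.
  rewrite -expRM_natl mulrC divfK //.
  by rewrite lE lnK // posrE ltr0n.
rewrite sqrtr_sqr ger0_norm ?expR_ge0 //.
by apply: le_trans (expR_ge1Dx _); lra.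
Qed.

Theorem theorem1p3 :
  exists prog : seq instr,
    @linear_time Rdefinitions.R prog /\
    forall eps : Rdefinitions.R, 0 < eps ->
      exists N : nat, forall n : nat, (N <= n)%N ->
        forall (d : measure_display) (T : measurableType d)
               (P : probability T Rdefinitions.R) (X : nat -> T -> Rdefinitions.R * Rdefinitions.R),
          iid_uniform_Sn P n X ->
          exists E : set T, measurable E /\
            (forall w : T,
               ~ succeeds prog (fun v => X v w) n
                   (1197%:R / 1000%:R * Num.sqrt (ln (n%:R : Rdefinitions.R))) -> E w) /\
            (P E <= eps%:E)%E.
Proof.
exists embed_prog; split; first exact: embed_linear.
pose R := Rdefinitions.R.
move=> eps eps0.
pose c : R := 1 / (20 * 100).
have c0 : 0 < c by rewrite /c divr_gt0.
pose K := (Num.truncn (18 / c ^+ 2)).+1.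
have Kc : 18 <= K%:R * c ^+ 2.
  by rewrite -ler_pdivrMr ?exprn_gt0 // ltW // truncnS_gt.
(* By exp(-y) <= 1 / y, the bound of [bad_fraction] is at most A / lam^2. *)
pose A : R := (8 * K + 16)%N%:R * (8 / c ^+ 2) + 16.
have A0 : 0 < A by rewrite /A ltr_wpDl // mulr_ge0 // divr_ge0 // sqr_ge0.
(* The term A / eps makes A / lam^2 at most eps, and 24000 makes lam^2 / 2, a lower bound of sqrt n,
   at least 12000 lam. *)
have [N HN] := sqrt_ln_eventually (A / eps + 240 * 100).
exists N => n Nn d T P X iid.
have [n0 lamL lamE] := HN n Nn.
set lam := Num.sqrt (ln (n%:R : R)) in lamL lamE *.
have Ae : 0 < A / eps by rewrite divr_gt0.
have lam_big : 240 * 100 <= lam by lra.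
have lamA : A / eps <= lam by lra.
have lam0 : 0 < lam by lra.
have [M Mn nM] := isqrt_exists n.
have M0 : (0 < M)%N by case: M nM {Mn} => //; case: n n0 {Nn HN iid lamL lamE lam lam_big lamA lam0}.
pose B := (Num.truncn (c * lam)).+1.
have cl0 : 0 <= c * lam by rewrite mulr_ge0 // ltW.
have /andP[b1 b2] := truncn_itv cl0.
have scales : [/\ c = 1 / (20 * 100), 50 * 100 <= lam, 120 * 100 * lam <= Num.sqrt n%:R,
    c * lam <= B%:R & B%:R <= c * lam + 1].
  split=> //; first by lra.
  - have := sqrt_exp_lower n0 lamE; nra.
  - exact: ltW.
  - by rewrite /B -natr1 lerD2r.
have [_ _ S_big cB _] := scales.
have [_ BM _] := grid_large nM scales.
have [E [mE EX PE]] := discretization n0 M0 iid (bad n M (2 * (c * lam * Num.sqrt n%:R)) B).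
exists E; split=> //; split.
  move=> w ns; apply: contrapT => /EX[f fB fw]; apply: ns.
  exact: (good_succeeds Mn nM scales fw fB).
rewrite PE lee_fin.
have S0 : 0 < Num.sqrt (n%:R : R) by rewrite sqrtr_gt0 ltr0n.
apply: le_trans (bad_fraction (K := K) c0 _ Kc M0 Mn BM S0 _ (ltW lam0) lamE _ _ _) _ => //.
- by rewrite sqr_sqrtr.
- by rewrite /c; lra.
- by rewrite /c; lra.
- by rewrite ler_sqr ?nnegrE.
have l20 : 0 < lam ^+ 2 by rewrite exprn_gt0.
have e1 : expR (- (c * lam) ^+ 2 / 8) <= (8 / c ^+ 2) / lam ^+ 2.
  have y0 : 0 < (c * lam) ^+ 2 / 8 by rewrite divr_gt0 // exprn_gt0 // mulr_gt0.
  rewrite mulNr; apply: le_trans (expRN_le_inv y0) _.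
  by rewrite exprMn !invfM invrK; lra.
have e2 : expR (- lam ^+ 2) <= (lam ^+ 2)^-1 by exact: expRN_le_inv.
have Ale : A / lam ^+ 2 <= eps.
  rewrite ler_pdivrMr //; move: lamA; rewrite ler_pdivrMr // => lamA.
  have : lam * eps <= lam ^+ 2 * eps by rewrite ler_wpM2r ?ltW // expr2; nra.
  by rewrite [leRHS]mulrC; lra.
apply: le_trans Ale; rewrite /A [leRHS]mulrDl -[X in _ <= X + _]mulrA; apply: lerD.
  by rewrite ler_wpM2l.
by rewrite ler_wpM2l.
Qed.
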